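(* Let $Y\in M_s(\mathbb{C})^g$ be a semisimple point and $\mathcal{I}(Y)=\{p\in\mathbb{C}\langle x\rangle\colon p(Y)=0\}$, where $x=(x_1,\dots,x_g)$. Then $$\mathcal{O}_Y=\varprojlim_\ell\big(\mathbb{C}\langle x\rangle/\mathcal{I}(Y)^\ell\big),$$ where the equality means a canonical isomorphism of algebras (compatible with the natural homomorphisms from $\mathbb{C}\langle x\rangle$ to both sides).
   Context: $\mathbb{C}\langle x\rangle$ is the free algebra in $x_1,\dots,x_g$. A point $Y\in M_s(\mathbb{C})^g$ is semisimple if every subspace of $\mathbb{C}^s$ invariant under $Y_1,\dots,Y_g$ admits a complementary invariant subspace. For $S\in M_s(\mathbb{C})$ and $Z\in M_s(\mathbb{C})^g$ write $SZ=(SZ_1,\dots,SZ_g)$, $ZS=(Z_1S,\dots,Z_gS)$, $[S,Z]=SZ-ZS$. $\mathcal{O}_Y$ is the algebra of formal nc germs about $Y$: its elements are sequences $(f_\ell)_{\ell=0}^\infty$ of $\ell$-linear maps $f_\ell:(M_s(\mathbb{C})^g)^\ell\to M_s(\mathbb{C})$ (with $f_0\in M_s(\mathbb{C})$) satisfying the canonical intertwining conditions with respect to $Y$: $f_1([S,Y])=[S,f_0]$ and for $\ell\ge2$, $$f_\ell([S,Y],Z^1,\dots,Z^{\ell-1})=Sf_{\ell-1}(Z^1,\dots,Z^{\ell-1})-f_{\ell-1}(SZ^1,Z^2,\dots,Z^{\ell-1}),$$ $$f_\ell(\dots,Z^j,[S,Y],Z^{j+1},\dots)=f_{\ell-1}(\dots,Z^{j-1},Z^jS,Z^{j+1},\dots)-f_{\ell-1}(\dots,Z^j,SZ^{j+1},Z^{j+2},\dots),$$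 $$f_\ell(Z^1,\dots,Z^{\ell-1},[S,Y])=f_{\ell-1}(Z^1,\dots,Z^{\ell-2},Z^{\ell-1}S)-f_{\ell-1}(Z^1,\dots,Z^{\ell-1})S$$ for $1\le j\le\ell-2$ and all $S\in M_s(\mathbb{C})$, $Z^j\in M_s(\mathbb{C})^g$. Addition is termwise and multiplication is convolution: $(fh)_\ell(Z^1,\dots,Z^\ell)=\sum_{i=0}^\ell f_i(Z^1,\dots,Z^i)\,h_{\ell-i}(Z^{i+1},\dots,Z^\ell)$. The natural homomorphism $\mathbb{C}\langle x\rangle\to\mathcal{O}_Y$ sends $p$ to $(\Delta^\ell_Yp)_\ell$, where $\Delta^0_Yp=p(Y)$ and $\Delta^\ell_Yp(Z^1,\dots,Z^\ell)$ is the top-right $s\times s$ block of $p$ evaluated at the $(\ell+1)\times(\ell+1)$ block upper bidiagonal point with diagonal blocks $Y$ and superdiagonal blocks $Z^1,\dots,Z^\ell$. *)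

(* Defs.v *)
From HB Require Import structures.
From mathcomp Require Import all_boot all_order all_algebra.
From mathcomp Require Import generic_quotient ring_quotient.
From mathcomp Require Import finmap monalg.
From mathcomp Require Import boolp.

Set Implicit Arguments.
Unset Strict Implicit.
Unset Printing Implicit Defensive.

Import GRing.Theory.
Local Open Scope ring_scope.
Local Open Scope quotient_scope.

Section Ideals.
Variables (K : fieldType) (A : algType K).

(* Two-sided ideals; properness is included because [algType] only has
   nonzero algebras.  Closure under scaling follows from [c *: x = c%:A * x]. *)
Record ideal := Ideal {
  ideal_mem :> A -> Prop;
  ideal0 : ideal_mem 0;
  idealD : forall x y, ideal_mem x -> ideal_mem y -> ideal_mem (x + y);
  idealMl : forall a x, ideal_mem x -> ideal_mem (a * x);
  idealMr : forall a x, ideal_mem x -> ideal_mem (x * a);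
  ideal1 : ~ ideal_mem 1 }.

Variable J : ideal.

Definition ideal_pred : {pred A} := fun x => `[< J x >].

Fact ideal_zmod_closed : zmod_closed ideal_pred.
Proof.
split=> [|x y /asboolP Jx /asboolP Jy]; apply/asboolP; first exact: ideal0.
by apply: idealD => //; rewrite -mulN1r; apply: idealMl.
Qed.
HB.instance Definition _ := GRing.isZmodClosed.Build A ideal_pred
  ideal_zmod_closed.

Definition quot_alg := Quotient.quot ideal_pred.
HB.instance Definition _ := GRing.Zmodule.on quot_alg.
HB.instance Definition _ := Quotient.on quot_alg.

Definition quot_pi (a : A) : quot_alg := \pi_(Quotient.quot ideal_pred) a.

Lemma quot_pi_eq a b : quot_pi a = quot_pi b <-> J (a - b).
Proof.
rewrite /quot_pi; split => [/eqP|/asboolP ab].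
  by rewrite -Quotient.idealrBE => /asboolP.
by apply/eqP; rewrite -Quotient.idealrBE.
Qed.

Lemma quot_piK (x : quot_alg) : quot_pi (repr x) = x.
Proof. exact: reprK. Qed.

Lemma quot_repr a : J (repr (quot_pi a) - a).
Proof. by apply/quot_pi_eq; rewrite quot_piK. Qed.

Lemma quot_piD a b : quot_pi (a + b) = quot_pi a + quot_pi b.
Proof. exact: Quotient.pi_add. Qed.

Definition quot_one : quot_alg := quot_pi 1.
Definition quot_mul (x y : quot_alg) : quot_alg := quot_pi (repr x * repr y).
Definition quot_scale (c : K) (x : quot_alg) : quot_alg := quot_pi (c *: repr x).

Lemma quot_piM a b : quot_pi (a * b) = quot_mul (quot_pi a) (quot_pi b).
Proof.
apply/esym/quot_pi_eq; set a' := repr _; set b' := repr _.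
have -> : a' * b' - a * b = (a' - a) * b' + a * (b' - b).
  by rewrite mulrBl mulrBr addrA subrK.
by apply: idealD; [apply: idealMr|apply: idealMl]; apply: quot_repr.
Qed.

Lemma quot_piZ c a : quot_pi (c *: a) = quot_scale c (quot_pi a).
Proof.
apply/esym/quot_pi_eq; rewrite -scalerBr -mulr_algl.
by apply: idealMl; apply: quot_repr.
Qed.

Fact quot_mulA : associative quot_mul.
Proof.
by move=> x y z; rewrite -[x]quot_piK -[y]quot_piK -[z]quot_piK -!quot_piM mulrA.
Qed.
Fact quot_mul1l : left_id quot_one quot_mul.
Proof. by move=> x; rewrite -[x]quot_piK -quot_piM mul1r. Qed.
Fact quot_mul1r : right_id quot_one quot_mul.
Proof. by move=> x; rewrite -[x]quot_piK -quot_piM mulr1. Qed.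
Fact quot_mulDl : left_distributive quot_mul +%R.
Proof.
move=> x y z; rewrite -[x]quot_piK -[y]quot_piK -[z]quot_piK.
by rewrite -quot_piD -!quot_piM -quot_piD mulrDl.
Qed.
Fact quot_mulDr : right_distributive quot_mul +%R.
Proof.
move=> x y z; rewrite -[x]quot_piK -[y]quot_piK -[z]quot_piK.
by rewrite -quot_piD -!quot_piM -quot_piD mulrDr.
Qed.
Fact quot_one_neq0 : quot_one != 0.
Proof.
apply/eqP; have -> : (0 : quot_alg) = quot_pi 0.
  by apply: (addrI 0); rewrite addr0 -{2}[0]quot_piK -quot_piD addr0 quot_piK.
by move=> /quot_pi_eq; rewrite subr0; apply: ideal1.
Qed.
HB.instance Definition _ := GRing.Zmodule_isNzRing.Build quot_alg
  quot_mulA quot_mul1l quot_mul1r quot_mulDl quot_mulDr quot_one_neq0.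

Fact quot_scaleA a b x : quot_scale a (quot_scale b x) = quot_scale (a * b) x.
Proof. by rewrite -[x]quot_piK -!quot_piZ scalerA. Qed.
Fact quot_scale1 : left_id 1 quot_scale.
Proof. by move=> x; rewrite -[x]quot_piK -!quot_piZ scale1r. Qed.
Fact quot_scaleDr : right_distributive quot_scale +%R.
Proof.
move=> a x y; rewrite -[x]quot_piK -[y]quot_piK.
by rewrite -quot_piD -!quot_piZ -quot_piD scalerDr.
Qed.
Fact quot_scaleDl x : {morph quot_scale^~ x : a b / a + b}.
Proof. by move=> a b; rewrite -[x]quot_piK -!quot_piZ -quot_piD scalerDl. Qed.
HB.instance Definition _ := GRing.Zmodule_isLmodule.Build K quot_alg
  quot_scaleA quot_scale1 quot_scaleDr quot_scaleDl.

Let mulE a b : quot_pi a * quot_pi b = quot_pi (a * b).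
Proof. by rewrite quot_piM. Qed.
Let scaleE c a : c *: quot_pi a = quot_pi (c *: a).
Proof. by rewrite quot_piZ. Qed.

Fact quot_scaleAl (a : K) (x y : quot_alg) : a *: (x * y) = a *: x * y.
Proof.
rewrite -[x]quot_piK -[y]quot_piK; move: (repr x) (repr y) => u v.
by rewrite (mulE u v) (scaleE a (u * v)) (scaleE a u) (mulE (a *: u) v) scalerAl.
Qed.
HB.instance Definition _ := GRing.Lmodule_isLalgebra.Build K quot_alg
  quot_scaleAl.
Fact quot_scaleAr (a : K) (x y : quot_alg) : a *: (x * y) = x * (a *: y).
Proof.
rewrite -[x]quot_piK -[y]quot_piK; move: (repr x) (repr y) => u v.
by rewrite (mulE u v) (scaleE a (u * v)) (scaleE a v) (mulE u (a *: v)) scalerAr.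
Qed.
HB.instance Definition _ := GRing.Lalgebra_isAlgebra.Build K quot_alg
  quot_scaleAr.

Fact quot_pi_zmod_morphism : zmod_morphism quot_pi.
Proof.
by move=> a b; apply: (addIr (quot_pi b)); rewrite -quot_piD !subrK.
Qed.
HB.instance Definition _ := GRing.isZmodMorphism.Build A quot_alg quot_pi
  quot_pi_zmod_morphism.
Fact quot_pi_monoid_morphism : monoid_morphism quot_pi.
Proof. by split=> // a b; apply: quot_piM. Qed.
HB.instance Definition _ := GRing.isMonoidMorphism.Build A quot_alg quot_pi
  quot_pi_monoid_morphism.
Fact quot_pi_scalable : scalable quot_pi.
Proof. by move=> c a; apply: quot_piZ. Qed.
HB.instance Definition _ := GRing.isScalable.Build K A quot_alg *:%R quot_pi
  quot_pi_scalable.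

Definition ideal_mul_set (I1 I2 : A -> Prop) : A -> Prop := fun x =>
  exists2 r : seq (A * A), (forall ab, ab \in r -> I1 ab.1 /\ I2 ab.2) &
    x = \sum_(ab <- r) ab.1 * ab.2.

Fixpoint ideal_pow_set (n : nat) : A -> Prop :=
  if n is m.+1 then ideal_mul_set (ideal_pow_set m) J else fun=> True.

Lemma ideal_mul_set0 I1 I2 : ideal_mul_set I1 I2 0.
Proof. by exists [::] => //; rewrite big_nil. Qed.

Lemma ideal_mul_setD I1 I2 x y :
  ideal_mul_set I1 I2 x -> ideal_mul_set I1 I2 y -> ideal_mul_set I1 I2 (x + y).
Proof.
move=> [r rI ->] [t tI ->]; exists (r ++ t); last by rewrite big_cat.
by move=> ab; rewrite mem_cat => /orP[/rI|/tI].
Qed.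

Lemma ideal_mul_setMl (I1 I2 : A -> Prop) a x :
    (forall b y, I1 y -> I1 (b * y)) ->
  ideal_mul_set I1 I2 x -> ideal_mul_set I1 I2 (a * x).
Proof.
move=> I1M [r rI ->]; exists [seq (a * ab.1, ab.2) | ab <- r].
  by move=> _ /mapP[ab /rI[h1 h2] ->]; split=> //; apply: I1M.
by rewrite big_map mulr_sumr; apply: eq_bigr => ab _; rewrite mulrA.
Qed.

Lemma ideal_mul_setMr (I1 I2 : A -> Prop) a x :
    (forall b y, I2 y -> I2 (y * b)) ->
  ideal_mul_set I1 I2 x -> ideal_mul_set I1 I2 (x * a).
Proof.
move=> I2M [r rI ->]; exists [seq (ab.1, ab.2 * a) | ab <- r].
  by move=> _ /mapP[ab /rI[h1 h2] ->]; split=> //; apply: I2M.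
by rewrite big_map mulr_suml; apply: eq_bigr => ab _; rewrite mulrA.
Qed.

Lemma ideal_pow_setMl n a x : ideal_pow_set n x -> ideal_pow_set n (a * x).
Proof.
by elim: n a x => //= n IHn a x; apply: ideal_mul_setMl => b y; apply: IHn.
Qed.

Lemma ideal_pow_setMr n a x : ideal_pow_set n x -> ideal_pow_set n (x * a).
Proof.
case: n a x => //= n a x; apply: ideal_mul_setMr => b y; exact: idealMr.
Qed.

Lemma ideal_pow_set_decr n x : ideal_pow_set n.+1 x -> ideal_pow_set n x.
Proof.
case: n => // n /= [r rI ->]; rewrite -/(ideal_pow_set n.+1) big_seq.
apply: (big_ind (ideal_pow_set n.+1)).
- exact: ideal_mul_set0.
- by move=> y z; apply: ideal_mul_setD.
- by move=> ab /rI[h _]; apply: ideal_pow_setMr.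
Qed.

Lemma ideal_pow_set_sub n x : ideal_pow_set n.+1 x -> J x.
Proof.
move=> [r rI ->]; rewrite big_seq; apply: (big_ind J); first exact: ideal0.
  by move=> y z; apply: idealD.
by move=> ab /rI[_ h]; apply: idealMl.
Qed.

Fact ideal_pow1 n : ~ ideal_pow_set n.+1 1.
Proof. by move=> /ideal_pow_set_sub; apply: ideal1. Qed.

(* [ideal_powS n] is the power of exponent [n.+1]: the power of exponent [0]
   is the whole algebra, hence not an [ideal]. *)
Definition ideal_powS (n : nat) : ideal :=
  @Ideal (ideal_pow_set n.+1) (@ideal_mul_set0 _ _) (@ideal_mul_setD _ _)
    (@ideal_pow_setMl n.+1) (@ideal_pow_setMr n.+1) (@ideal_pow1 n).

End Ideals.

Section QuotientProjection.
Variables (K : fieldType) (A : algType K) (I J : ideal A).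
Hypothesis sIJ : forall x, I x -> J x.

(* The inclusion is taken as an argument so that the morphism instances below
   can be keyed on [quot_proj]. *)
Definition quot_proj of (forall x, I x -> J x) :=
  fun x : quot_alg I => quot_pi J (repr x).
Local Notation proj := (quot_proj sIJ).

Lemma quot_projE a : proj (quot_pi I a) = quot_pi J a.
Proof. by apply/quot_pi_eq/sIJ/quot_repr. Qed.

Fact quot_proj_zmod_morphism : zmod_morphism proj.
Proof.
move=> x y; rewrite -[x]quot_piK -[y]quot_piK.
by rewrite -raddfB !quot_projE raddfB.
Qed.
HB.instance Definition _ := GRing.isZmodMorphism.Build
  (quot_alg I) (quot_alg J) proj quot_proj_zmod_morphism.
Fact quot_proj_monoid_morphism : monoid_morphism proj.
Proof.
split=> [|x y]; first by rewrite -(rmorph1 (quot_pi I)) quot_projE rmorph1.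
rewrite -[x]quot_piK -[y]quot_piK.
by rewrite -rmorphM !quot_projE rmorphM.
Qed.
HB.instance Definition _ := GRing.isMonoidMorphism.Build
  (quot_alg I) (quot_alg J) proj quot_proj_monoid_morphism.
Fact quot_proj_scalable : scalable proj.
Proof.
by move=> c x; rewrite -[x]quot_piK -linearZ !quot_projE linearZ.
Qed.
HB.instance Definition _ := GRing.isScalable.Build K
  (quot_alg I) (quot_alg J) *:%R proj quot_proj_scalable.

End QuotientProjection.

Section InverseLimit.
Variables (K : fieldType) (A_ : nat -> algType K).
Variable p_ : forall l, {lrmorphism A_ l.+1 -> A_ l}.

Record invlim := InvLim {
  invlim_val : forall l, A_ l;
  invlim_compat : forall l, p_ l (invlim_val l.+1) = invlim_val l }.

Lemma invlimP (x y : invlim) :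
  (forall l, invlim_val x l = invlim_val y l) -> x = y.
Proof.
case: x y => x xP [y yP] /= exy; have exy' : x = y by apply: functional_extensionality_dep.
by case: y / exy' yP {exy} => yP; rewrite (Prop_irrelevance xP yP).
Qed.

HB.instance Definition _ := gen_eqMixin invlim.
HB.instance Definition _ := gen_choiceMixin invlim.

Local Notation "x @ l" := (invlim_val x l) (at level 8, l at level 8).

Fact invlim_zero_compat l : p_ l 0 = 0. Proof. exact: raddf0. Qed.
Definition invlim_zero := InvLim invlim_zero_compat.
Fact invlim_opp_compat x l : p_ l (- x@(l.+1)) = - x@l.
Proof. by rewrite raddfN /= invlim_compat. Qed.
Definition invlim_opp x := InvLim (invlim_opp_compat x).
Fact invlim_add_compat x y l : p_ l (x@(l.+1) + y@(l.+1)) = x@l + y@l.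
Proof. by rewrite raddfD /= !invlim_compat. Qed.
Definition invlim_add x y :=
  @InvLim (fun l => x@l + y@l) (invlim_add_compat x y).
Fact invlim_one_compat l : p_ l 1 = 1. Proof. exact: rmorph1. Qed.
Definition invlim_one := InvLim invlim_one_compat.
Fact invlim_mul_compat x y l : p_ l (x@(l.+1) * y@(l.+1)) = x@l * y@l.
Proof. by rewrite rmorphM /= !invlim_compat. Qed.
Definition invlim_mul x y :=
  @InvLim (fun l => x@l * y@l) (invlim_mul_compat x y).
Fact invlim_scale_compat c x l : p_ l (c *: x@(l.+1)) = c *: x@l.
Proof. by rewrite linearZ /= invlim_compat. Qed.
Definition invlim_scale c x :=
  @InvLim (fun l => c *: x@l) (invlim_scale_compat c x).

Fact invlim_addA : associative invlim_add.
Proof. by move=> x y z; apply: invlimP => l /=; rewrite addrA. Qed.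
Fact invlim_addC : commutative invlim_add.
Proof. by move=> x y; apply: invlimP => l /=; rewrite addrC. Qed.
Fact invlim_add0 : left_id invlim_zero invlim_add.
Proof. by move=> x; apply: invlimP => l /=; rewrite add0r. Qed.
Fact invlim_addN : left_inverse invlim_zero invlim_opp invlim_add.
Proof. by move=> x; apply: invlimP => l /=; rewrite addNr. Qed.
HB.instance Definition _ := GRing.isZmodule.Build invlim
  invlim_addA invlim_addC invlim_add0 invlim_addN.

Fact invlim_mulA : associative invlim_mul.
Proof. by move=> x y z; apply: invlimP => l /=; rewrite mulrA. Qed.
Fact invlim_mul1l : left_id invlim_one invlim_mul.
Proof. by move=> x; apply: invlimP => l /=; rewrite mul1r. Qed.
Fact invlim_mul1r : right_id invlim_one invlim_mul.
Proof. by move=> x; apply: invlimP => l /=; rewrite mulr1. Qed.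
Fact invlim_mulDl : left_distributive invlim_mul +%R.
Proof. by move=> x y z; apply: invlimP => l /=; rewrite mulrDl. Qed.
Fact invlim_mulDr : right_distributive invlim_mul +%R.
Proof. by move=> x y z; apply: invlimP => l /=; rewrite mulrDr. Qed.
Fact invlim_one_neq0 : invlim_one != 0.
Proof.
by apply/eqP => /(congr1 (fun x => x@0)) /eqP; rewrite (negPf (oner_neq0 _)).
Qed.
HB.instance Definition _ := GRing.Zmodule_isNzRing.Build invlim
  invlim_mulA invlim_mul1l invlim_mul1r invlim_mulDl invlim_mulDr
  invlim_one_neq0.

Fact invlim_scaleA a b x :
  invlim_scale a (invlim_scale b x) = invlim_scale (a * b) x.
Proof. by apply: invlimP => l /=; rewrite scalerA. Qed.
Fact invlim_scale1 : left_id 1 invlim_scale.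
Proof. by move=> x; apply: invlimP => l /=; rewrite scale1r. Qed.
Fact invlim_scaleDr : right_distributive invlim_scale +%R.
Proof. by move=> a x y; apply: invlimP => l /=; rewrite scalerDr. Qed.
Fact invlim_scaleDl x : {morph invlim_scale^~ x : a b / a + b}.
Proof. by move=> a b; apply: invlimP => l /=; rewrite scalerDl. Qed.
HB.instance Definition _ := GRing.Zmodule_isLmodule.Build K invlim
  invlim_scaleA invlim_scale1 invlim_scaleDr invlim_scaleDl.

Fact invlim_scaleAl (a : K) (x y : invlim) : a *: (x * y) = a *: x * y.
Proof. by apply: invlimP => l /=; rewrite scalerAl. Qed.
HB.instance Definition _ := GRing.Lmodule_isLalgebra.Build K invlim
  invlim_scaleAl.
Fact invlim_scaleAr (a : K) (x y : invlim) : a *: (x * y) = x * (a *: y).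
Proof. by apply: invlimP => l /=; rewrite scalerAr. Qed.
HB.instance Definition _ := GRing.Lalgebra_isAlgebra.Build K invlim
  invlim_scaleAr.

End InverseLimit.

Section AdicCompletion.
Variables (K : fieldType) (A : algType K) (J : ideal A).

Lemma ideal_powS_decr l x : ideal_powS J l.+1 x -> ideal_powS J l x.
Proof. exact: ideal_pow_set_decr. Qed.

(* The inverse limit of the [A / J ^ (l + 1)], [l : nat], along the canonical
   projections.  Dropping the trivial quotient [A / J ^ 0 = 0] does not change
   the limit. *)
Definition adic_completion : algType K :=
  @invlim K (fun l => quot_alg (ideal_powS J l) : algType K)
    (fun l => quot_proj (@ideal_powS_decr l)).

Fact to_completion_compat a l :
  quot_proj (@ideal_powS_decr l) (quot_pi (ideal_powS J l.+1) a)
    = quot_pi (ideal_powS J l) a.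
Proof. exact: quot_projE. Qed.

Definition to_completion (a : A) : adic_completion :=
  InvLim (to_completion_compat a).

Fact to_completion_zmod_morphism : zmod_morphism to_completion.
Proof. by move=> a b; apply: invlimP => l /=; rewrite raddfB. Qed.
HB.instance Definition _ := GRing.isZmodMorphism.Build A adic_completion
  to_completion to_completion_zmod_morphism.
Fact to_completion_monoid_morphism : monoid_morphism to_completion.
Proof.
split=> [|a b]; apply: invlimP => l /=; [exact: rmorph1|exact: rmorphM].
Qed.
HB.instance Definition _ := GRing.isMonoidMorphism.Build A adic_completion
  to_completion to_completion_monoid_morphism.
Fact to_completion_scalable : scalable to_completion.
Proof. by move=> c a; apply: invlimP => l /=; rewrite linearZ. Qed.
HB.instance Definition _ := GRing.isScalable.Build K A adic_completion *:%R
  to_completion to_completion_scalable.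

End AdicCompletion.

Section FreeAlgebra.
Variables (K : fieldType) (g : nat).

Definition ncpoly := {malg K[{fmonom 'I_g}]}.
HB.instance Definition _ := GRing.Lalgebra.on ncpoly.

Fact ncpoly_scaleAr (c : K) (p q : ncpoly) : c *: (p * q) = p * (c *: q).
Proof.
suff comm r : r * c%:MP = c *: r :> {malg K[{fmonom 'I_g}]}.
  by rewrite -(comm (p * q : {malg _[_]})) -(comm q) mulrA.
rewrite malgM_def fgmulgU malgZ_def; apply: eq_bigr => w _.
by rewrite mulm1 mulrC.
Qed.
HB.instance Definition _ := GRing.Lalgebra_isAlgebra.Build K ncpoly
  ncpoly_scaleAr.

Definition ncpoly_eval n (X : 'I_g -> 'M[K]_n) (p : ncpoly) : 'M[K]_n :=
  \sum_(w <- msupp p) p@_w *: \prod_(i <- w) X i.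


Section Morphism.
Variables (B : algType K) (h : {mmorphism {fmonom 'I_g} -> B}).

Lemma sum_ncpolyE (p : ncpoly) :
  \sum_(w <- msupp p) p@_w *: h w = mmap (in_alg B) h p.
Proof. by apply: eq_bigr => w _; rewrite mulr_algl. Qed.

Fact ncpoly_sum_zmod_morphism :
  zmod_morphism (fun p : ncpoly => \sum_(w <- msupp p) p@_w *: h w).
Proof. by move=> p q; rewrite !sum_ncpolyE mmapB. Qed.
Fact ncpoly_sum_monoid_morphism :
  monoid_morphism (fun p : ncpoly => \sum_(w <- msupp p) p@_w *: h w).
Proof.
have [] := @commr_mmap_is_multiplicative _ _ _ (in_alg B) h.
  by move=> p w v; rewrite /GRing.comm mulr_algl mulr_algr.
by move=> hM h1; split=> [|p q]; rewrite !sum_ncpolyE; [exact: h1|exact: hM].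
Qed.
Fact ncpoly_sum_scalable :
  scalable (fun p : ncpoly => \sum_(w <- msupp p) p@_w *: h w).
Proof. by move=> c p; rewrite !sum_ncpolyE mmapZ mulr_algl. Qed.
End Morphism.

Section Eval.
Variables (n : nat) (X : 'I_g -> 'M[K]_n.+1).

Definition fmonom_eval (w : {fmonom 'I_g}) : 'M[K]_n.+1 := \prod_(i <- w) X i.

Fact fmonom_eval_mmorphism : mmorphism fmonom_eval.
Proof.
by split=> [v w|]; rewrite /fmonom_eval ?fm1 ?big_nil // fmM big_cat.
Qed.
HB.instance Definition _ := isMultiplicative.Build {fmonom 'I_g} 'M[K]_n.+1
  fmonom_eval fmonom_eval_mmorphism.

HB.instance Definition _ := GRing.isZmodMorphism.Build ncpoly 'M[K]_n.+1
  (ncpoly_eval X) (ncpoly_sum_zmod_morphism fmonom_eval).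
HB.instance Definition _ := GRing.isMonoidMorphism.Build ncpoly 'M[K]_n.+1
  (ncpoly_eval X) (ncpoly_sum_monoid_morphism fmonom_eval).
HB.instance Definition _ := GRing.isScalable.Build K ncpoly 'M[K]_n.+1 *:%R
  (ncpoly_eval X) (ncpoly_sum_scalable fmonom_eval).
End Eval.

End FreeAlgebra.

Section Points.
Variables (K : fieldType) (g s : nat).

(* Matrices have size [s.+1] so that they form a nonzero algebra. *)
Definition point := {ffun 'I_g -> 'M[K]_s.+1}.
HB.instance Definition _ := GRing.Lmodule.on point.

Implicit Types (S : 'M[K]_s.+1) (Y Z : point).

Definition lmul_point S Z : point := [ffun i => S * Z i].
Definition rmul_point Z S : point := [ffun i => Z i * S].
Definition comm_point S Z : point := lmul_point S Z - rmul_point Z S.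

Definition invariant_subspace Y (U : {vspace 'cV[K]_s.+1}) :=
  forall i v, v \in U -> Y i *m v \in U.

Definition semisimple_point Y :=
  forall U : {vspace 'cV[K]_s.+1}, invariant_subspace Y U ->
    exists2 W : {vspace 'cV[K]_s.+1}, invariant_subspace Y W &
      (U + W = fullv)%VS /\ (U :&: W = 0)%VS.

Variable Y : point.

Definition vanishing (p : ncpoly K g) := ncpoly_eval Y p = 0.

Fact vanishing0 : vanishing 0. Proof. exact: raddf0. Qed.
Fact vanishingD p q : vanishing p -> vanishing q -> vanishing (p + q).
Proof. by rewrite /vanishing raddfD /= => -> ->; rewrite addr0. Qed.
Fact vanishingMl a p : vanishing p -> vanishing (a * p).
Proof. by rewrite /vanishing rmorphM /= => ->; rewrite mulr0. Qed.
Fact vanishingMr a p : vanishing p -> vanishing (p * a).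
Proof. by rewrite /vanishing rmorphM /= => ->; rewrite mul0r. Qed.
Fact vanishing1 : ~ vanishing 1.
Proof. by rewrite /vanishing rmorph1 => /eqP; rewrite oner_eq0. Qed.

Definition vanishing_ideal : ideal (ncpoly K g) :=
  Ideal vanishing0 vanishingD vanishingMl vanishingMr vanishing1.

End Points.

Section Germs.
Variables (K : fieldType) (g s : nat).
Local Notation M := 'M[K]_s.+1.
Local Notation pt := (point K g s).
Implicit Types (S : M) (Y Z : pt) (u v : seq pt).

(* A sequence of maps [f_l] on [l]-tuples of points is the same thing as one
   map on finite sequences of points, [f_l] being its restriction to the
   sequences of size [l]. *)
Record is_germ Y (f : seq pt -> M) : Prop := IsGerm {
  germ_linear : forall u v c Z Z',
    f (u ++ (c *: Z + Z') :: v) = c *: f (u ++ Z :: v) + f (u ++ Z' :: v);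
  germ_comm1 : forall S, f [:: comm_point S Y] = S * f [::] - f [::] * S;
  germ_comm_first : forall S Z v,
    f (comm_point S Y :: Z :: v) = S * f (Z :: v) - f (lmul_point S Z :: v);
  germ_comm_mid : forall S u Z Z' v,
    f (u ++ [:: Z, comm_point S Y, Z' & v])
      = f (u ++ [:: rmul_point Z S, Z' & v])
        - f (u ++ [:: Z, lmul_point S Z' & v]);
  germ_comm_last : forall S u Z,
    f (u ++ [:: Z; comm_point S Y])
      = f (u ++ [:: rmul_point Z S]) - f (u ++ [:: Z]) * S }.

Record germ Y := Germ { germ_fun :> seq pt -> M; germP : is_germ Y germ_fun }.

Definition convolution (f h : seq pt -> M) (v : seq pt) : M :=
  \sum_(i < (size v).+1) f (take i v) * h (drop i v).

Lemma convolution_nil f h : convolution f h [::] = f [::] * h [::].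
Proof. by rewrite /convolution big_ord_recl big_ord0 addr0. Qed.

Lemma convolution_cons f h z v :
  convolution f h (z :: v) =
    f [::] * h (z :: v) + convolution (fun u => f (z :: u)) h v.
Proof. by rewrite /convolution big_ord_recl; congr (_ + _). Qed.

Lemma convolution_cat_cons f h u z v :
  convolution f h (u ++ z :: v) =
    \sum_(i < (size u).+1) f (take i u) * h (drop i u ++ z :: v)
    + convolution (fun w => f (u ++ z :: w)) h v.
Proof.
elim: u f => [|y u IHu] f /=.
  by rewrite convolution_cons big_ord_recl big_ord0 addr0.
by rewrite convolution_cons IHu addrA; congr (_ + _); rewrite [RHS]big_ord_recl.
Qed.

Lemma eq_convolution f f' h : f =1 f' -> convolution f h =1 convolution f' h.
Proof. by move=> ff' v; apply: eq_bigr => i _; rewrite ff'. Qed.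

Lemma convolutionDl f f' h v :
  convolution (fun u => f u + f' u) h v = convolution f h v + convolution f' h v.
Proof. by rewrite -big_split; apply: eq_bigr => i _; rewrite mulrDl. Qed.

Lemma convolutionDr f h h' v :
  convolution f (fun u => h u + h' u) v = convolution f h v + convolution f h' v.
Proof. by rewrite -big_split; apply: eq_bigr => i _; rewrite mulrDr. Qed.

Lemma convolutionZl c f h v :
  convolution (fun u => c *: f u) h v = c *: convolution f h v.
Proof. by rewrite scaler_sumr; apply: eq_bigr => i _; rewrite scalerAl. Qed.

Lemma convolutionZr c f h v :
  convolution f (fun u => c *: h u) v = c *: convolution f h v.
Proof. by rewrite scaler_sumr; apply: eq_bigr => i _; rewrite scalerAr. Qed.

Lemma convolutionMl a f h v :
  convolution (fun u => a * f u) h v = a * convolution f h v.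
Proof. by rewrite mulr_sumr; apply: eq_bigr => i _; rewrite mulrA. Qed.

Lemma convolutionNl f h v :
  convolution (fun u => - f u) h v = - convolution f h v.
Proof. by rewrite -sumrN; apply: eq_bigr => i _; rewrite mulNr. Qed.

Lemma convolutionBl f f' h v :
  convolution (fun u => f u - f' u) h v = convolution f h v - convolution f' h v.
Proof. by rewrite convolutionDl convolutionNl. Qed.

Lemma convolutionA f h k v :
  convolution f (convolution h k) v = convolution (convolution f h) k v.
Proof.
elim: v f h => [|z v IHv] f h; first by rewrite !convolution_nil mulrA.
rewrite 2!convolution_cons IHv [RHS]convolution_cons convolution_nil.
under [in RHS]eq_convolution => u do rewrite convolution_cons.
by rewrite convolutionDl convolutionMl mulrDr mulrA addrA.
Qed.

Variable Y : pt.

Lemma germ_eq (f h : germ Y) : germ_fun f =1 germ_fun h -> f = h.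
Proof.
case: f h => f fP [h hP] /= fh; have fh' : f = h by apply: funext.
by case: h / fh' hP {fh} => hP; rewrite (Prop_irrelevance fP hP).
Qed.

HB.instance Definition _ := gen_eqMixin (germ Y).
HB.instance Definition _ := gen_choiceMixin (germ Y).

Fact is_germ0 : is_germ Y (fun=> 0).
Proof. by split=> *; rewrite ?scaler0 ?mulr0 ?mul0r ?subr0 ?addr0. Qed.
Definition germ0 := Germ is_germ0.

Fact is_germ_scale c (f : germ Y) : is_germ Y (fun v => c *: f v).
Proof.
case: f => f [fl f1 ff fm fe] /=; split=> [u v a Z Z'|S|S Z v|S u Z Z' v|S u Z].
- by rewrite fl scalerDr !scalerA mulrC.
- by rewrite f1 scalerBr -scalerAl -scalerAr.
- by rewrite ff scalerBr -scalerAr.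
- by rewrite fm scalerBr.
- by rewrite fe scalerBr -scalerAl.
Qed.
Definition germ_scale c f := Germ (is_germ_scale c f).

Fact is_germ_add (f h : germ Y) : is_germ Y (fun v => f v + h v).
Proof.
case: f h => f [fl f1 ff fm fe] [h [hl h1 hf hm he]] /=.
split=> [u v a Z Z'|S|S Z v|S u Z Z' v|S u Z].
- by rewrite fl hl scalerDr addrACA.
- by rewrite f1 h1 mulrDr mulrDl opprD addrACA.
- by rewrite ff hf mulrDr opprD addrACA.
- by rewrite fm hm opprD addrACA.
- by rewrite fe he mulrDl opprD addrACA.
Qed.
Definition germ_add f h := Germ (is_germ_add f h).
Definition germ_opp f := germ_scale (-1) f.

Fact is_germ1 : is_germ Y (fun v => (v == [::])%:R).
Proof.
split=> [u v c Z Z'|S|S Z v|S u Z Z' v|S u Z] /=; try by case: u => [|? ?] /=;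
  rewrite ?scaler0 ?addr0 ?subr0 ?mul0r ?oppr0 ?addr0.
- by rewrite mulr1 mul1r subrr.
- by rewrite mulr0 subr0.
Qed.
Definition germ1 := Germ is_germ1.

Let zmod_idl (V : zmodType) (a b c d e : V) :
  (a - b) + ((c - a) + (d - e)) = (c + d) - (b + e).
Proof. by rewrite addrA [a - b + (c - a)]addrC subrKA opprD addrACA. Qed.

Fact is_germ_mul (f h : germ Y) : is_germ Y (convolution f h).
Proof.
case: f h => f [fl f1 ff fm fe] [h [hl h1 hf hm he]] /=.
split=> [u v a Z Z'|S|S Z v|S u Z Z' v|S u Z].
- rewrite !convolution_cat_cons.
  under eq_bigr => i _ do rewrite hl mulrDr -scalerAr.
  rewrite big_split -scaler_sumr /=.
  under eq_convolution => w do rewrite fl.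
  by rewrite convolutionDl convolutionZl scalerDr addrACA.
- rewrite !convolution_cons !convolution_nil h1 f1 mulrBr mulrBl !mulrA.
  by rewrite addrC subrKA.
- rewrite !convolution_cons hf f1.
  under eq_convolution => w do rewrite ff.
  rewrite convolutionBl convolutionMl mulrBr mulrBl mulrDr !mulrA.
  exact: zmod_idl.
- rewrite !convolution_cat_cons !convolution_cons.
  rewrite hf fe mulrBr mulrBl !mulrA.
  under eq_bigr => i _ do rewrite hm mulrBr.
  under eq_convolution => w do rewrite fm.
  by rewrite convolutionBl sumrB zmod_idl [in RHS]opprD [RHS]addrACA.
- rewrite !convolution_cat_cons convolution_cons !convolution_nil h1 fe.
  under eq_bigr => i _ do rewrite he mulrBr mulrA.
  rewrite sumrB -mulr_suml mulrBr mulrBl !mulrA mulrDl opprD.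
  by rewrite [_ - _ + (_ - _)]addrC subrKA addrACA.
Qed.
Definition germ_mul f h := Germ (is_germ_mul f h).

Fact germ_addA : associative germ_add.
Proof. by move=> x y z; apply: germ_eq => v /=; rewrite addrA. Qed.
Fact germ_addC : commutative germ_add.
Proof. by move=> x y; apply: germ_eq => v /=; rewrite addrC. Qed.
Fact germ_add0 : left_id germ0 germ_add.
Proof. by move=> x; apply: germ_eq => v /=; rewrite add0r. Qed.
Fact germ_addN : left_inverse germ0 germ_opp germ_add.
Proof. by move=> x; apply: germ_eq => v /=; rewrite scaleN1r addNr. Qed.
HB.instance Definition _ := GRing.isZmodule.Build (germ Y)
  germ_addA germ_addC germ_add0 germ_addN.

Fact germ_mulA : associative germ_mul.
Proof. by move=> x y z; apply: germ_eq => v /=; rewrite convolutionA. Qed.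
Fact germ_mul1l : left_id germ1 germ_mul.
Proof.
move=> x; apply: germ_eq => -[|z v] /=.
  by rewrite convolution_nil mul1r.
rewrite convolution_cons mul1r /convolution big1 ?addr0 // => i _.
by rewrite mul0r.
Qed.
Fact germ_mul1r : right_id germ1 germ_mul.
Proof.
move=> x; apply: germ_eq => v /=; rewrite /convolution big_ord_recr /=.
rewrite take_size drop_size mulr1 big1 ?add0r // => i _.
by rewrite -size_eq0 size_drop subn_eq0 leqNgt ltn_ord mulr0.
Qed.
Fact germ_mulDl : left_distributive germ_mul +%R.
Proof. by move=> x y z; apply: germ_eq => v; apply: convolutionDl. Qed.
Fact germ_mulDr : right_distributive germ_mul +%R.
Proof. by move=> x y z; apply: germ_eq => v; apply: convolutionDr. Qed.
Fact germ_one_neq0 : germ1 != 0.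
Proof.
apply/eqP => /(congr1 (fun f : germ Y => f [::])) /= /eqP.
by rewrite oner_eq0.
Qed.
HB.instance Definition _ := GRing.Zmodule_isNzRing.Build (germ Y)
  germ_mulA germ_mul1l germ_mul1r germ_mulDl germ_mulDr germ_one_neq0.

Fact germ_scaleA a b x : germ_scale a (germ_scale b x) = germ_scale (a * b) x.
Proof. by apply: germ_eq => v /=; rewrite scalerA. Qed.
Fact germ_scale1 : left_id 1 germ_scale.
Proof. by move=> x; apply: germ_eq => v /=; rewrite scale1r. Qed.
Fact germ_scaleDr : right_distributive germ_scale +%R.
Proof. by move=> a x y; apply: germ_eq => v /=; rewrite scalerDr. Qed.
Fact germ_scaleDl x : {morph germ_scale^~ x : a b / a + b}.
Proof. by move=> a b; apply: germ_eq => v /=; rewrite scalerDl. Qed.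
HB.instance Definition _ := GRing.Zmodule_isLmodule.Build K (germ Y)
  germ_scaleA germ_scale1 germ_scaleDr germ_scaleDl.

Fact germ_scaleAl (a : K) (x y : germ Y) : a *: (x * y) = a *: x * y.
Proof. by apply: germ_eq => v; apply/esym/convolutionZl. Qed.
HB.instance Definition _ := GRing.Lmodule_isLalgebra.Build K (germ Y)
  germ_scaleAl.
Fact germ_scaleAr (a : K) (x y : germ Y) : a *: (x * y) = x * (a *: y).
Proof. by apply: germ_eq => v; apply/esym/convolutionZr. Qed.
HB.instance Definition _ := GRing.Lalgebra_isAlgebra.Build K (germ Y)
  germ_scaleAr.

Definition bidiagonal_point (v : seq pt) (i : 'I_g) :
    'M[K]_(\sum_(j < (size v).+1) s.+1) :=
  \mxblock_(j < (size v).+1, k < (size v).+1)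
    if k == j then Y i else if k == j.+1 :> nat then nth 0 v j i else 0.

Definition ncdiff (p : ncpoly K g) (v : seq pt) : M :=
  submxblock (ncpoly_eval (bidiagonal_point v) p) ord0 ord_max.

Fixpoint word_diff (w : seq 'I_g) (v : seq pt) : M :=
  if w is i :: w' then
    Y i * word_diff w' v + (if v is z :: v' then z i * word_diff w' v' else 0)
  else (v == [::])%:R.

Lemma submxblock_word w v (a : 'I_(size v).+1) :
  submxblock (\prod_(i <- w) bidiagonal_point v i) a ord_max
    = word_diff w (drop a v).
Proof.
elim: w a => [|i w IHw] a /=.
  rewrite big_nil -[1]/(1%:M) -(@mxdiagZ _ _ (fun=> s.+1)) mxblockK.
  rewrite -size_eq0 size_drop subn_eq0.
  rewrite -(inj_eq val_inj) /= eqn_leq -ltnS ltn_ord /=.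
  by case: leqP => _; rewrite ?conform_mx_id.
rewrite big_cons.
have := submxblockK (\prod_(i <- w) bidiagonal_point v i) => {1}<-.
rewrite [_ * _]mul_mxblock mxblockK (bigD1 a) //= eqxx IHw; congr (_ + _).
have [av|va] := ltnP a (size v); last first.
  rewrite drop_oversize // big1 // => j ja; rewrite (negPf ja).
  case: eqP => [ja1|_]; last by rewrite mul0mx.
  by have := ltn_ord j; rewrite ja1 ltnS ltnNge va.
have a1v : (a.+1 < (size v).+1)%N by [].
rewrite (bigD1 (Ordinal a1v)) /=; last by rewrite -(inj_eq val_inj) /= gtn_eqF.
rewrite eqxx -(inj_eq val_inj) /= gtn_eqF // IHw /= (drop_nth 0 av).
rewrite big1 ?addr0 // => j /andP[/negPf ja /negPf ja1].
by rewrite ja -[j == a.+1 :> nat]/(j == Ordinal a1v :> nat) (inj_eq val_inj) ja1 mul0mx.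
Qed.

Lemma word_diff_comm1 w S :
  word_diff w [:: comm_point S Y] = S * word_diff w [::] - word_diff w [::] * S.
Proof.
elim: w => [|i w IHw] /=; first by rewrite mulr1 mul1r subrr.
by rewrite IHw !ffunE !addr0 mulrBr mulrBl !mulrA addrC subrKA.
Qed.

Lemma word_diff_comm_first w S Z v :
  word_diff w (comm_point S Y :: Z :: v)
    = S * word_diff w (Z :: v) - word_diff w (lmul_point S Z :: v).
Proof.
elim: w => [|i w IHw] /=; first by rewrite mulr0 subr0.
rewrite IHw !ffunE mulrBr mulrBl mulrDr !mulrA [LHS]addrC subrKA.
by rewrite opprD addrACA subrr addr0.
Qed.

Fact is_germ_word w : is_germ Y (word_diff w).
Proof.
split; [|exact: word_diff_comm1|exact: word_diff_comm_first| |].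
- move=> u v c Z Z'; elim: w u => [|i w IHw] u /=.
    by case: u => [|? ?] /=; rewrite scaler0 addr0.
  rewrite IHw; case: u => [|z u] /=.
    by rewrite !ffunE mulrDr mulrDl scalerDr -scalerAl -scalerAr addrACA.
  by rewrite IHw !mulrDr -!scalerAr scalerDr addrACA.
- move=> S u Z Z' v; elim: w u => [|i w IHw] u /=.
    by case: u => [|? ?] /=; rewrite subr0.
  rewrite IHw; case: u => [|z u] /=.
    by rewrite word_diff_comm_first !ffunE !mulrBr !mulrA opprD addrACA.
  by rewrite IHw !mulrBr opprD addrACA.
- move=> S u Z; elim: w u => [|i w IHw] u /=.
    by case: u => [|? ?] /=; rewrite mul0r subr0.
  rewrite IHw; case: u => [|z u] /=.
    by rewrite word_diff_comm1 !ffunE !mulrBr mulrDl !mulrA opprD addrACA.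
  by rewrite IHw !mulrBr mulrDl !mulrA opprD addrACA.
Qed.
Definition word_germ (w : {fmonom 'I_g}) := Germ (is_germ_word w).

Lemma word_diffM w1 w2 v :
  word_diff (w1 ++ w2) v = convolution (word_diff w1) (word_diff w2) v.
Proof.
elim: w1 v => [|i w1 IHw] v /=.
  exact: (esym (congr1 (fun f : germ Y => f v)
            (germ_mul1l (Germ (is_germ_word w2))))).
rewrite IHw; case: v => [|z v].
  by rewrite !convolution_nil /= !addr0 mulrA.
rewrite IHw !convolution_cons /= addr0 mulrDr mulrA -addrA; congr (_ + _).
by rewrite convolutionDl !convolutionMl.
Qed.

Fact word_germ_mmorphism : mmorphism word_germ.
Proof.
split=> [w1 w2|]; apply: germ_eq => v; last by rewrite /= fm1.
by rewrite [LHS]/= fmM word_diffM.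
Qed.
HB.instance Definition _ := isMultiplicative.Build {fmonom 'I_g} (germ Y)
  word_germ word_germ_mmorphism.

Lemma ncdiffE p v :
  ncdiff p v = germ_fun (\sum_(w <- msupp p) p@_w *: word_germ w) v.
Proof.
rewrite /ncdiff /ncpoly_eval.
rewrite (big_morph (fun f : germ Y => f v) (fun _ _ => erefl) erefl) /=.
rewrite (big_morph (fun A => submxblock A ord0 ord_max)
  (fun _ _ => submxblockD _ _ _ _) (submxblock0 _ _)).
apply: eq_bigr => w _; have := @submxblock_word w v ord0; rewrite drop0 => <-.
by apply/matrixP => i j; rewrite !mxE.
Qed.

Fact is_germ_ncdiff p : is_germ Y (ncdiff p).
Proof. by rewrite (funext (ncdiffE p)); apply: germP. Qed.

Definition to_germ (p : ncpoly K g) : germ Y := Germ (is_germ_ncdiff p).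

Lemma to_germE p : to_germ p = \sum_(w <- msupp p) p@_w *: word_germ w.
Proof. by apply: germ_eq => v; apply: ncdiffE. Qed.

Fact to_germ_zmod_morphism : zmod_morphism to_germ.
Proof. by move=> p q; rewrite !to_germE; exact: (ncpoly_sum_zmod_morphism word_germ p q). Qed.
HB.instance Definition _ := GRing.isZmodMorphism.Build (ncpoly K g) (germ Y)
  to_germ to_germ_zmod_morphism.
Fact to_germ_monoid_morphism : monoid_morphism to_germ.
Proof.
have [h1 hM] := ncpoly_sum_monoid_morphism word_germ.
by split=> [|p q]; rewrite !to_germE; [exact: h1|exact: hM].
Qed.
HB.instance Definition _ := GRing.isMonoidMorphism.Build (ncpoly K g) (germ Y)
  to_germ to_germ_monoid_morphism.
Fact to_germ_scalable : scalable to_germ.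
Proof. by move=> c p; rewrite !to_germE; exact: (ncpoly_sum_scalable word_germ c p). Qed.
HB.instance Definition _ := GRing.isScalable.Build K (ncpoly K g) (germ Y)
  *:%R to_germ to_germ_scalable.

End Germs.

(* Main.v *)
From HB Require Import structures.
Require Import Defs.
From mathcomp Require Import all_boot all_order all_algebra.
From mathcomp Require Import finmap monalg boolp.
From mathcomp Require Import reals complex.

Set Implicit Arguments.
Unset Strict Implicit.
Unset Printing Implicit Defensive.

Import GRing.Theory.
Local Open Scope ring_scope.

(** Write M for the s-by-s matrices, A for the image of the free algebra in M
    under p |-> p(Y), A' for the commutant of Y, I for the vanishing ideal and
    E_de for the matrix units.  The theorem reduces to two facts.

    - [ideal_powP]: I^n consists of the polynomials whose Taylor coefficients
      at Y of order less than n vanish.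
    - [germ_approximation]: the coefficients of order less than n of a germ
      are those of some polynomial.

    Sending a germ to the classes modulo I^n of polynomials that approximate
    it to order n is then well defined and injective.  It is onto because the
    conditions that define a germ relate only two consecutive orders, so that
    a compatible family of polynomials can be glued into a germ.

    Semisimplicity enters once, in [semisimple_lift].  As a left module, M is
    a sum of copies of the module of column vectors, so A has an invariant
    complement in M, and the projection pi of M onto A along it commutes with
    left multiplication by Y.  Hence pi is given by right multiplications by
    matrix units and left multiplications by elements of A',
    pi(S) = sum_k T_k S E_k with T_k in A' and sum_k T_k E_k = 1.  Choose a
    linear map lambda from M to the polynomials that lifts pi, in the sense
    that lambda(S)(Y) = pi(S).  The polynomials
    beta_(i,S) = x_i lambda(S) - lambda(Y_i S) then belong to I.

    For the first fact, [fox_expansion] telescopes every word from the right: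
    q lambda(1) - lambda(q(Y)) = sum r_(i,d,e) beta_(i,E_de), where the Taylor
    coefficient of q at (u, Z) is sum (r_(i,d,e) at u) Z_i E_de.  If the
    coefficients of q of order at most n vanish, those of each r_(i,d,e) vanish
    in order less than n, because the matrices E_de are linearly independent.
    By induction r_(i,d,e) lies in I^n, so q lambda(1) lies in I^(n+1); and
    q - q lambda(1) lies there as well, because q lies in I^n and
    1 - lambda(1) in I.

    For the second fact, subtract an approximation of order n: the coefficient
    f of order n becomes the first nonzero one.  The intertwining conditions of
    order n say that f vanishes as soon as one argument is [S, Y]; those of
    order n + 1 with S in A', where [S, Y] = 0, say that f is a map of
    A'-bimodules, balanced between consecutive arguments
    ([leading_term_germ]).  Expand f along its last argument,
    f(u, Z) = sum f_(i,d,e)(u) Z_i E_de.  The coefficients f_(i,d,e) have the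
    same properties, so by induction they come from polynomials p_(i,d,e) in
    I^(n-1), and sum p_(i,d,e) beta_(i,E_de) realizes f
    ([realize_leading_term]).  Indeed, the coefficient of order 1 of
    beta_(i,S) at Z is Z_i pi(S) + Y_i h(S) - h(Y_i S), where h(S) is the
    coefficient of lambda(S) at Z.  The terms with h cancel because f(u, [S, Y])
    vanishes ([slice_comm]), and pi can be dropped because f is right
    A'-linear ([slice_lift]). *)

(** * Subspaces of maximal dimension *)

Lemma exists_maximal_vspace (K : fieldType) (V : vectType K)
    (Q : {vspace V} -> Prop) (U0 : {vspace V}) :
  Q U0 -> exists2 U, Q U & forall U', Q U' -> (U <= U')%VS -> U' = U.
Proof.
move=> Q0; pose P n := `[< exists2 U, Q U & \dim U = n >].
have exP : exists n, P n by exists (\dim U0); apply/asboolP; exists U0.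
have ubP n : P n -> (n <= \dim {:V})%N.
  by move=> /asboolP[U _ <-]; apply: dimvS; apply: subvf.
case: (ex_maxnP exP ubP) => _ /asboolP[U QU <-] Umax; exists U => // U' QU' sUU'.
apply/esym/eqP; rewrite eqEdim sUU' /=; apply: Umax; apply/asboolP.
by exists U'.
Qed.

(** A maximal subspace inside P contains every vector satisfying P: adjoining
    one more such vector stays inside P. *)
Lemma linear_pred_vspace (K : fieldType) (V : vectType K) (P : V -> Prop) :
    P 0 -> (forall c u v, P u -> P v -> P (c *: u + v)) ->
  exists U : {vspace V}, forall v, v \in U <-> P v.
Proof.
move=> P0 PD.
have [|U QU Umax] :=
  @exists_maximal_vspace _ _ (fun U => forall v, v \in U -> P v) 0%VS.
  by move=> v; rewrite memv0 => /eqP->.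
exists U => v; split=> [/QU//|Pv].
suff <- : (U + <[v]>)%VS = U by rewrite memvE addvSr.
apply: Umax (addvSl _ _) => _ /memv_addP[u /QU Pu [_ /vlineP[c ->] ->]].
by rewrite addrC; apply: PD.
Qed.

(** * Invariant complements in the matrix algebra *)

Section Semisimple.
Variables (K : fieldType) (g s : nat) (Y : point K g s).
Local Notation M := 'M[K]_s.+1.

Definition left_invariant (U : {vspace M}) :=
  forall i S, S \in U -> Y i * S \in U.

Lemma left_invariantD U W :
  left_invariant U -> left_invariant W -> left_invariant (U + W).
Proof.
move=> invU invW i _ /memv_addP[u uU [w wW ->]].
by rewrite mulrDr memv_add ?invU ?invW.
Qed.

Definition col_embed (c : 'I_s.+1) : 'Hom('cV[K]_s.+1, M) :=
  linfun (mulmxr (delta_mx 0 c : 'rV[K]_s.+1)).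

Lemma col_embedE c v : col_embed c v = v *m delta_mx 0 c.
Proof. by rewrite lfunE. Qed.

Lemma col_embedM c i v : Y i * col_embed c v = col_embed c (Y i *m v).
Proof. by rewrite !col_embedE; apply: mulmxA. Qed.

Lemma sum_col_embed (S : M) : S = \sum_c col_embed c (col c S).
Proof.
rewrite -[LHS]mulmx1; apply/matrixP => r e.
rewrite mulmx1 summxE (bigD1 e) //= col_embedE !mxE big_ord1 !mxE !eqxx mulr1.
rewrite big1 ?addr0 // => c ce; rewrite col_embedE !mxE big_ord1 !mxE.
by rewrite (eq_sym e) (negPf ce) andbF mulr0.
Qed.

(** Complements pass from the module of column vectors to a sum of copies of
    it.  Take W maximal among the invariant subspaces that meet U trivially.
    The preimage N of U + W in any copy of the column vectors has an invariant
    complement N', and W plus the image of N' still meets U trivially.  By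
    maximality N' already lies in W, hence in N, so N' = 0 and the whole copy
    lies in U + W. *)
Lemma left_invariant_complement U :
    semisimple_point Y -> left_invariant U ->
  exists2 W, left_invariant W & (U + W = fullv)%VS /\ (U :&: W = 0)%VS.
Proof.
move=> ssY invU.
have [|W [invW UW0] Wmax] := @exists_maximal_vspace _ _
    (fun W => left_invariant W /\ (U :&: W = 0)%VS) 0%VS.
  by split; [move=> i S; rewrite memv0 => /eqP->; rewrite mulr0 mem0v|rewrite capv0].
exists W => //; split=> //.
have sub c : (limg (col_embed c) <= U + W)%VS.
  pose N := (col_embed c @^-1: (U + W))%VS.
  have memN v : (v \in N) = (col_embed c v \in (U + W)%VS) by rewrite memv_preim.
  have [|N' invN' [NN' N0]] := ssY N.
    move=> i v; rewrite !memN -col_embedM; exact: left_invariantD.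
  have WN' : (W + col_embed c @: N')%VS = W.
    apply: Wmax (addvSl _ _); split.
      apply: left_invariantD => // i _ /memv_imgP[v vN' ->].
      by rewrite col_embedM memv_img ?invN'.
    apply/eqP; rewrite -subv0; apply/subvP => S.
    rewrite memv_cap => /andP[SU /memv_addP[w wW [_ /memv_imgP[v vN' ->] S_wv]]].
    have vN : v \in N.
      rewrite memN; have -> : col_embed c v = S - w by rewrite S_wv addrC addKr.
      by rewrite memv_add // memvN.
    have v0 : v = 0 by apply/eqP; rewrite -memv0 -N0 memv_cap vN.
    rewrite -UW0 memv_cap SU; rewrite S_wv v0 linear0 addr0; exact: wW.
  have N'N : (N' <= N)%VS.
    apply/subvP => v vN'; rewrite memN.
    by rewrite (subvP (addvSr U W)) // -WN' (subvP (addvSr _ _)) // memv_img.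
  apply/subvP => _ /memv_imgP[v _ ->].
  by rewrite -memN; move/addv_idPl: N'N; rewrite NN' => <-; apply: memvf.
apply/eqP; rewrite eqEsubv subvf; apply/subvP => S _.
rewrite [S]sum_col_embed; apply: memv_suml => c _.
by apply: (subvP (sub c)); apply: memv_img; apply: memvf.
Qed.

End Semisimple.

(** * Matrix units and tensors of matrices *)

Section MatrixUnits.
Variables (K : fieldType) (s : nat).
Local Notation M := 'M[K]_s.+1.
Local Notation idx := ('I_s.+1 * 'I_s.+1)%type.

Definition mxunit (k : idx) : M := delta_mx k.1 k.2.

Lemma sum_mxunit (S : M) : S = \sum_k S k.1 k.2 *: mxunit k.
Proof. by rewrite [LHS]matrix_sum_delta pair_bigA. Qed.

Lemma mulmx_unitE (a : M) k r c :
  (a * mxunit k) r c = (c == k.2)%:R * a r k.1.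
Proof.
rewrite mxE (bigD1 k.1) //= !mxE eqxx mulrC big1 ?addr0 // => j jk.
by rewrite !mxE (negPf jk) mulr0.
Qed.

Lemma mul_mxunitE (a b : M) k r c : (a * mxunit k * b) r c = a r k.1 * b k.2 c.
Proof.
rewrite mxE (bigD1 k.2) //= mulmx_unitE eqxx mul1r big1 ?addr0 // => j jk.
by rewrite mulmx_unitE (negPf jk) !mul0r.
Qed.

(** The map from the tensor square of M to End(M) that sends a (x) b to
    S |-> a S b is injective, so it determines the value of a (x) b |-> a h(b).
    Injectivity is seen by taking matrix units for S. *)
Lemma sandwich_eq (I J : finType) (a b : I -> M) (a' b' : J -> M)
    (h : {linear M -> M}) :
    (forall S, \sum_k a k * S * b k = \sum_k a' k * S * b' k) ->
  \sum_k a k * h (b k) = \sum_k a' k * h (b' k).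
Proof.
move=> ab.
have expand (I' : finType) (a1 b1 : I' -> M) : \sum_k a1 k * h (b1 k)
    = \sum_t (\matrix_(r, c) (\sum_k a1 k * mxunit (c, t.1) * b1 k) r t.2)
        * h (mxunit t).
  under eq_bigr => k _ do
    rewrite {1}[b1 k]sum_mxunit linear_sum /= mulr_sumr.
  rewrite exchange_big /=; apply: eq_bigr => t _.
  under eq_bigr => k _ do rewrite linearZ /= -scalerAr scalerAl.
  rewrite -mulr_suml; congr (_ * _); apply/matrixP => r c.
  by rewrite mxE !summxE; apply: eq_bigr => k _; rewrite mul_mxunitE mxE mulrC.
rewrite (expand I) (expand J); apply: eq_bigr => t _; congr (_ * _).
by apply/matrixP => r c; rewrite !mxE ab.
Qed.

End MatrixUnits.

(** * A polynomial lift of the projection onto the image algebra *)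

Section Lifts.
Variables (K : fieldType) (g s : nat) (Y : point K g s).
Local Notation M := 'M[K]_s.+1.
Local Notation idx := ('I_s.+1 * 'I_s.+1)%type.

Definition generator (i : 'I_g) : ncpoly K g := mkmalgU (fmu i) 1.

Definition mxlift (L : idx -> ncpoly K g) (S : M) : ncpoly K g :=
  \sum_k S k.1 k.2 *: L k.

Fact mxlift_linear L : linear (mxlift L).
Proof.
move=> c S T; rewrite /mxlift scaler_sumr -big_split; apply: eq_bigr => k _ /=.
by rewrite !mxE scalerDl scalerA.
Qed.
HB.instance Definition _ L := GRing.isLinear.Build K M (ncpoly K g) *:%R
  (mxlift L) (mxlift_linear L).

Lemma ncpoly_eval_generator i : ncpoly_eval Y (generator i) = Y i.
Proof.
rewrite /ncpoly_eval msuppU1 big_seq_fset1 mcoeffUU scale1r.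
by rewrite /= /fmu fmE big_seq1.
Qed.

Lemma comm_point0P T : comm_point T Y = 0 <-> forall i, T * Y i = Y i * T.
Proof.
split=> [TY i|TY]; last first.
  by apply/ffunP => i; rewrite !ffunE TY subrr.
by apply/eqP; rewrite -subr_eq0; move/ffunP/(_ i): TY; rewrite !ffunE => ->.
Qed.

(** [L] lifts an equivariant projection P of the matrix algebra onto the
    algebra generated by Y.  The matrices [T k] are the blocks of P, viewed as
    an endomorphism of a direct sum of copies of the column vectors; these
    blocks commute with Y since P does. *)
Lemma semisimple_lift : semisimple_point Y ->
  exists L (T : idx -> M),
  [/\ forall k, comm_point (T k) Y = 0,
      forall S, ncpoly_eval Y (mxlift L S) = \sum_k T k * S * mxunit K k
    & ncpoly_eval Y (mxlift L 1) = 1].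
Proof.
move=> ssY.
have [||A memA] := @linear_pred_vspace K M (fun S => exists p, ncpoly_eval Y p = S).
- by exists 0; apply: raddf0.
- move=> c _ _ [p <-] [q <-]; exists (c *: p + q).
  by rewrite linearP.
have [|W invW [AW AW0]] := left_invariant_complement ssY (U := A).
  move=> i S /memA[p <-]; apply/memA; exists (generator i * p).
  by rewrite rmorphM /= ncpoly_eval_generator.
pose P := daddv_pi A W.
have PA S : P S \in A by apply: memv_pi.
have idP S : S \in A -> P S = S by apply: daddv_pi_id.
have addP S : P S + daddv_pi W A S = S by rewrite daddv_pi_add // AW memvf.
have P0 S : S \in W -> P S = 0.
  move=> SW; apply: (addIr (daddv_pi W A S)).
  by rewrite addP add0r daddv_pi_id // capvC.
have PM i S : P (Y i * S) = Y i * P S.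
  rewrite -{1}[S]addP mulrDr linearD /= [X in _ + X]P0; last first.
    by apply: invW; apply: memv_pi.
  rewrite addr0 idP //; have /memA[p <-] := PA S; apply/memA.
  by exists (generator i * p); rewrite rmorphM /= ncpoly_eval_generator.
have /choice[L LP] : forall k : idx, exists p, ncpoly_eval Y p = P (mxunit K k).
  by move=> k; apply/memA.
have evL S : ncpoly_eval Y (mxlift L S) = P S.
  rewrite [in RHS](sum_mxunit S) !linear_sum; apply: eq_bigr => k _ /=.
  by rewrite !linearZ /= LP.
(* [T (r, c)] is the block of P from column r to column c. *)
pose T (k : idx) : M := \matrix_(a, b) P (mxunit K (b, k.1)) a k.2.
exists L, T; split=> [k|S|].
- apply/comm_point0P => i; apply/matrixP => a b.
  have -> : (Y i * T k) a b = P (Y i * mxunit K (b, k.1)) a k.2.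
    by rewrite PM !mxE; apply: eq_bigr => d _; rewrite !mxE.
  rewrite [Y i * _]sum_mxunit linear_sum summxE mxE.
  rewrite -(pair_bigA _ (fun d r => P ((Y i * mxunit K (b, k.1)) d r *:
    mxunit K (d, r)) a k.2)) /=.
  apply: eq_bigr => d _; rewrite (bigD1 k.1) //= big1 => [|r rk].
    by rewrite addr0 mulmx_unitE eqxx mul1r linearZ /= !mxE mulrC.
  by rewrite mulmx_unitE (negPf rk) mul0r scale0r linear0 mxE.
- rewrite evL [in LHS](sum_mxunit S) linear_sum; apply/matrixP => a c.
  rewrite !summxE -(pair_bigA _ (fun b r => P (S b r *: mxunit K (b, r)) a c)).
  rewrite -(pair_bigA _ (fun r e => (T (r, e) * S * mxunit K (r, e)) a c)) /=.
  rewrite exchange_big /=; apply: eq_bigr => r _.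
  rewrite [RHS](bigD1 c) //= mulmx_unitE eqxx mul1r mxE.
  rewrite [X in _ = _ + X]big1 => [|e ec].
    by rewrite addr0; apply: eq_bigr => b _; rewrite linearZ !mxE mulrC.
  by rewrite mulmx_unitE eq_sym (negPf ec) mul0r.
- rewrite evL; apply: idP; apply/memA; exists 1; exact: rmorph1.
Qed.

End Lifts.

(** * Taylor coefficients of noncommutative polynomials *)

Arguments to_germ : simpl never.
Arguments germ_fun : simpl never.

Lemma linear_combM (K : fieldType) (A : algType K) (c : K) (p q m u v : A) :
  (c *: p + q) * m - (c *: u + v) = c *: (p * m - u) + (q * m - v).
Proof. by rewrite mulrDl -scalerAl opprD addrACA scalerBr. Qed.

Section Taylor.
Variables (K : fieldType) (g s : nat) (Y : point K g s).
Local Notation M := 'M[K]_s.+1.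
Local Notation pt := (point K g s).
Local Notation idx := ('I_s.+1 * 'I_s.+1)%type.
Local Notation gen := (@generator K g).
Local Notation taylor := (to_germ Y).
Local Notation unit := (@mxunit K s).

Lemma mkmalgU_cons i (w : seq 'I_g) :
  mkmalgU (FMonom (i :: w)) 1 = gen i * mkmalgU (FMonom w) 1 :> ncpoly K g.
Proof.
rewrite /generator [RHS]malgM_def fgmulUU mulr1; congr (mkmalgU _ _).
by apply: val_inj; rewrite /= fmM /fmu fmE.
Qed.

Lemma ncpoly_ind (P : ncpoly K g -> Prop) :
    P 1 -> (forall i p, P p -> P (gen i * p)) ->
    (forall c p q, P p -> P q -> P (c *: p + q)) ->
  forall p, P p.
Proof.
move=> P1 PM PD p.
have P0 : P 0 by have := PD (-1) 1 1 P1 P1; rewrite scaleN1r addNr.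
have Pw w : P (mkmalgU (FMonom w) 1).
  elim: w => [|i w IHw]; last by rewrite mkmalgU_cons; apply: PM.
  suff -> : mkmalgU (FMonom [::]) 1 = 1 :> ncpoly K g by [].
  by congr mkmalgU; apply: val_inj; rewrite /= fm1.
rewrite [p]monalgE; elim/big_rec: _ => [//|[w] q _ Pq].
suff -> : mkmalgU (FMonom w) (p@_(FMonom w)) =
    p@_(FMonom w) *: (mkmalgU (FMonom w) 1 : ncpoly K g) by apply: PD.
by rewrite -[RHS]mul_malgC [RHS]malgM_def fgmulUU mulr1 mul1m.
Qed.

Lemma taylor_nil p : taylor p [::] = ncpoly_eval Y p.
Proof.
rewrite [LHS]ncdiffE (big_morph (fun f : germ Y => f [::]) (fun _ _ => erefl) erefl).
apply: eq_bigr => -[w] _ /=; congr (_ *: _); rewrite -[LHS]/(word_diff Y w [::]).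
by elim: w => [|i w IHw] /=; rewrite ?big_nil // big_cons IHw addr0.
Qed.

Lemma taylor1 v : taylor 1 v = (v == [::])%:R.
Proof. by rewrite rmorph1. Qed.

Lemma taylorP c p q v :
  taylor (c *: p + q) v = c *: taylor p v + taylor q v.
Proof. by rewrite linearP. Qed.

Lemma taylorB p q v : taylor (p - q) v = taylor p v - taylor q v.
Proof.
rewrite raddfB -[LHS]/(taylor p v + (-1) *: taylor q v); congr (_ + _).
exact: scaleN1r.
Qed.

Lemma taylor_sum (I : finType) (F : I -> ncpoly K g) v :
  taylor (\sum_k F k) v = \sum_k taylor (F k) v.
Proof.
by rewrite raddf_sum (big_morph (fun f : germ Y => f v) (fun _ _ => erefl) erefl).
Qed.

Lemma taylor_generator i v : taylor (gen i) v = word_diff Y [:: i] v.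
Proof. 
rewrite [LHS]ncdiffE msuppU1 big_seq_fset1 mcoeffUU scale1r /=.
by rewrite /fmu fmE.
Qed.

Lemma taylor_generatorM i p v : taylor (gen i * p) v =
  Y i * taylor p v + (if v is z :: v' then z i * taylor p v' else 0).
Proof.
rewrite rmorphM -[LHS]/(convolution _ _ _).
rewrite (eq_convolution _ (taylor_generator i)).
case: v => [|z v].
  by rewrite convolution_nil /= !addr0 mulr1.
rewrite convolution_cons /= addr0 mulr1; congr (_ + _).
rewrite (_ : (fun u => _) = fun u => z i * (u == [::])%:R); last first.
  by apply: funext => u; rewrite mulr0 add0r.
rewrite convolutionMl; congr (_ * _).
exact: (congr1 (fun f : germ Y => f v) (germ_mul1l (taylor p))).
Qed.

Lemma sum_slot (V : lmodType K) (G : 'I_g -> M -> V) i (S : M) : linear (G i) ->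
  \sum_(k : 'I_g * idx) (S k.2.1 k.2.2 * (k.1 == i)%:R) *: G k.1 (unit k.2)
    = G i S.
Proof.
move=> linG; pose h : {linear M -> V} :=
  HB.pack (G i) (GRing.isLinear.Build K M V *:%R (G i) linG).
rewrite -(pair_bigA _ (fun j t => (S t.1 t.2 * (j == i)%:R) *: G j (unit t))) /=.
rewrite (bigD1 i) //= eqxx [X in _ + X]big1 ?addr0 => [|j ji]; last first.
  by rewrite (negPf ji); apply: big1 => t _; rewrite mulr0 scale0r.
rewrite -[RHS]/(h S) [in RHS](sum_mxunit S) linear_sum.
by apply: eq_bigr => t _; rewrite linearZ mulr1.
Qed.

(** The points [slot_point i t] form a basis of the space of points. *)
Definition slot_point i t : pt := [ffun j => if j == i then unit t else 0].

Lemma slot_sumE (a : 'I_g * idx -> M) i c d r e :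
  (\sum_k a k * slot_point i (c, d) k.1 * unit k.2) r e = a (i, (d, e)) r c.
Proof.
rewrite summxE (bigD1 (i, (d, e))) //= ffunE eqxx mul_mxunitE mxE !eqxx mulr1.
rewrite big1 ?addr0 // => -[j [d' e']] /=; rewrite !xpair_eqE ffunE.
have [->|_] := eqVneq j i; last by rewrite mulr0 mul0r mxE.
rewrite mul_mxunitE mxE /= (eq_sym d) (eq_sym e) => /negPf->.
by rewrite mulr0.
Qed.

(** The last argument of a Taylor coefficient can be stripped off without loss,
    since the maps Z |-> Z_i E_de have independent left coefficients. *)
Lemma slot_sum_inj (a : 'I_g * idx -> M) :
  (forall Z : pt, \sum_k a k * Z k.1 * unit k.2 = 0) -> forall k, a k = 0.
Proof.
move=> a0 [i [d e]]; apply/matrixP => r c.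
by rewrite -(slot_sumE a i c d r e) a0 !mxE.
Qed.

Definition slot_coef (F : pt -> M) (k : 'I_g * idx) : M :=
  \matrix_(r, c) F (slot_point k.1 (c, k.2.1)) r k.2.2.

Lemma slot_expansion (F : pt -> M) : linear F ->
  forall Z, F Z = \sum_k slot_coef F k * Z k.1 * unit k.2.
Proof.
move=> linF Z; pose h : {linear pt -> M} :=
  HB.pack F (GRing.isLinear.Build K pt M *:%R F linF).
have -> : Z = \sum_(k : 'I_g * idx) Z k.1 k.2.1 k.2.2 *: slot_point k.1 k.2.
  apply/ffunP => i; rewrite sum_ffunE.
  rewrite -[LHS](@sum_slot _ (fun=> id) i (Z i)) //.
  apply: eq_bigr => -[j t] _ /=; rewrite !ffunE eq_sym.
  by case: eqVneq => [->|_]; rewrite ?mulr1 // mulr0 scale0r scaler0.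
rewrite -[F]/(h : pt -> M) linear_sum.
under [RHS]eq_bigr => k _.
  rewrite sum_ffunE mulr_sumr mulr_suml.
  under eq_bigr => t _ do rewrite ffunE -scalerAr -scalerAl.
  over.
rewrite exchange_big /=; apply: eq_bigr => -[i [c d]] _ /=.
rewrite -[F _]/(h _) linearZ -scaler_sumr; congr (_ *: _).
by apply/matrixP => r e; rewrite slot_sumE mxE.
Qed.

Section Fox.
Variable L : idx -> ncpoly K g.

(** With L as in [semisimple_lift], these generate the vanishing ideal as a
    left ideal modulo its square. *)
Definition fox_gen (k : 'I_g * idx) : ncpoly K g :=
  gen k.1 * mxlift L (unit k.2) - mxlift L (Y k.1 * unit k.2).

(** The coefficients r are the Fox derivatives of q.  A word w = v x_i u
    contributes v times the entries of the matrix u(Y); summing over the letters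
    of w, the products of v with x_i lift(u(Y)) - lift(Y_i u(Y)) telescope. *)
Lemma fox_expansion q : exists r : 'I_g * idx -> ncpoly K g,
  q * mxlift L 1 - mxlift L (ncpoly_eval Y q) = \sum_k r k * fox_gen k /\
  forall u Z, taylor q (rcons u Z) = \sum_k taylor (r k) u * Z k.1 * unit k.2.
Proof.
elim/ncpoly_ind: q => [|i q [r [rq1 rq2]]|c p q [r [rp1 rp2]] [t [tq1 tq2]]].
- exists (fun=> 0); split=> [|u Z].
    rewrite (rmorph1 (ncpoly_eval Y)) mul1r subrr.
    by rewrite big1 // => k _; rewrite mul0r.
  rewrite rmorph1 big1 => [|k _]; last by rewrite raddf0 !mul0r.
  by case: u.
- pose e k := ncpoly_eval Y q k.2.1 k.2.2 * (k.1 == i)%:R.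
  exists (fun k => gen i * r k + (e k)%:A); split=> [|u Z].
    rewrite rmorphM /= ncpoly_eval_generator.
    under eq_bigr => k _ do rewrite mulrDl mulr_algl -mulrA.
    rewrite big_split /= -mulr_sumr -rq1.
    rewrite (sum_slot (G := fun i S => gen i * mxlift L S - mxlift L (Y i * S))).
      by rewrite mulrBr mulrA addrA subrK.
    move=> c S T; rewrite linearP /= [Y i * _]mulrDr -scalerAr linearP /=.
    rewrite mulrDr -scalerAr.
    by rewrite scalerBr opprD addrACA.
  rewrite taylor_generatorM.
  under eq_bigr => k _.
    rewrite addrC taylorP taylor1 taylor_generatorM addrC !mulrDl.
    over.
  rewrite !big_split /=.
  under eq_bigr => k _ do rewrite -!mulrA.
  rewrite -mulr_sumr.
  under [X in _ * X + _ + _]eq_bigr => k _ do rewrite mulrA.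
  rewrite -rq2 -addrA; congr (_ + _).
  case: u => [|y u] /=.
    rewrite big1 ?add0r => [|k _]; last by rewrite !mul0r.
    under eq_bigr => k _ do rewrite -!scalerAl mul1r.
    rewrite taylor_nil.
    rewrite (sum_slot (G := fun i S => Z i * S)) // => c S T.
    by rewrite mulrDr scalerAr.
  rewrite [X in _ + X]big1 ?addr0 => [|k _]; last by rewrite scaler0 !mul0r.
  rewrite rq2 mulr_sumr.
  by apply: eq_bigr => k _; rewrite !mulrA.
- exists (fun k => c *: r k + t k); split=> [|u Z].
    transitivity (c *: (\sum_k r k * fox_gen k) + \sum_k t k * fox_gen k).
      apply: etrans (congr2 (fun x y => c *: x + y) rp1 tq1).
      rewrite [ncpoly_eval Y _]linearP [mxlift L (_ + _)]linearP.
      exact: linear_combM.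
    rewrite scaler_sumr -big_split; apply: eq_bigr => k _ /=.
    by rewrite mulrDl scalerAl.
  rewrite taylorP rp2 tq2 scaler_sumr -big_split; apply: eq_bigr => k _ /=.
  by rewrite taylorP !mulrDl !scalerAl.
Qed.

End Fox.
End Taylor.

(** * Powers of the vanishing ideal and order of vanishing *)

Section Order.
Variables (K : fieldType) (g s : nat) (Y : point K g s).
Local Notation M := 'M[K]_s.+1.
Local Notation pt := (point K g s).
Local Notation idx := ('I_s.+1 * 'I_s.+1)%type.
Local Notation gen := (@generator K g).
Local Notation taylor := (to_germ Y).
Local Notation unit := (@mxunit K s).
Local Notation I_pow n := (ideal_pow_set (vanishing_ideal Y) n).

Definition vanish_below n (f : seq pt -> M) := forall v, (size v < n)%N -> f v = 0.

Lemma convolution_rcons f h u Z : vanish_below (size u) f -> h [::] = 0 ->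
  convolution f h (rcons u Z) = f u * h [:: Z].
Proof.
move=> f0 h0; rewrite /convolution size_rcons !big_ord_recr /= -cats1.
rewrite [drop _.+1 _]drop_oversize ?size_cat ?addn1 // h0 mulr0 addr0.
rewrite take_size_cat // drop_size_cat // big1 ?add0r // => i _.
by rewrite f0 ?mul0r // size_take size_cat addn1 ltnS (ltnW (ltn_ord i)) ltn_ord.
Qed.

Lemma vanish_convolution n f h : vanish_below n f -> h [::] = 0 ->
  vanish_below n.+1 (convolution f h).
Proof.
move=> f0 h0; elim/last_ind => [|u Z _]; first by rewrite convolution_nil h0 mulr0.
rewrite size_rcons ltnS => un; rewrite convolution_rcons //.
  by rewrite f0 // mul0r.
by move=> v vu; apply: f0; apply: ltn_trans vu un.
Qed.

Lemma ideal_pow_vanish n p : I_pow n p -> vanish_below n (taylor p).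
Proof.
elim: n p => [|n IHn] p; first by [].
move=> [r rI ->]; rewrite big_seq.
apply: (big_ind (fun q => vanish_below n.+1 (taylor q))).
- by move=> v _; rewrite raddf0.
- by move=> q q' q0 q0' v vn; rewrite -[q]scale1r taylorP q0 // q0' // scaler0 addr0.
- move=> ab /rI[/IHn a0 b0] v vn; rewrite rmorphM.
  by apply: vanish_convolution vn => //; rewrite taylor_nil.
Qed.

Lemma ideal_powM n p q : I_pow n p -> vanishing Y q -> I_pow n.+1 (p * q).
Proof.
move=> pI q0; exists [:: (p, q)]; last by rewrite big_seq1.
by move=> _ /[!inE] /eqP->.
Qed.

Lemma ideal_pow0 n : I_pow n 0.
Proof. by case: n => // n; apply: ideal_mul_set0. Qed.

Lemma ideal_powD n p q : I_pow n p -> I_pow n q -> I_pow n (p + q).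
Proof. by case: n => // n; apply: ideal_mul_setD. Qed.

Lemma ideal_pow_sum n (I : finType) (F : I -> ncpoly K g) :
  (forall k, I_pow n (F k)) -> I_pow n (\sum_k F k).
Proof.
by move=> FI; apply: big_ind => //; [apply: ideal_pow0|apply: ideal_powD].
Qed.

Section Lift.
Variables (L : idx -> ncpoly K g) (T : idx -> M).
Hypothesis TY : forall k, comm_point (T k) Y = 0.
Hypothesis LT : forall S, ncpoly_eval Y (mxlift L S) = \sum_k T k * S * unit k.
Hypothesis L1 : ncpoly_eval Y (mxlift L 1) = 1.

Lemma lift_equivariant i S :
  ncpoly_eval Y (mxlift L (Y i * S)) = Y i * ncpoly_eval Y (mxlift L S).
Proof.
rewrite [LHS]LT [X in _ = _ * X]LT mulr_sumr; apply: eq_bigr => k _; rewrite !mulrA.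
by move: (TY k) => /comm_point0P->.
Qed.

Lemma vanishing_fox_gen k : vanishing Y (fox_gen Y L k).
Proof.
rewrite /vanishing /fox_gen raddfB /= rmorphM /= ncpoly_eval_generator.
by rewrite [X in _ - X]lift_equivariant; apply: subrr.
Qed.

(** The Fox derivatives of p vanish to one order less than p, so
    [fox_expansion] puts p times [mxlift L 1] in the next power of the ideal;
    the second factor is 1 modulo the ideal. *)
Lemma vanish_ideal_pow n p : vanish_below n (taylor p) -> I_pow n p.
Proof.
elim: n p => // n IHn p p0.
have ev0 : ncpoly_eval Y p = 0 by rewrite -taylor_nil p0.
have [r [fox1 fox2]] := fox_expansion Y L p.
have rI k : I_pow n (r k).
  apply: IHn => u un; move: k; apply: slot_sum_inj => Z.
  by rewrite -fox2 p0 ?size_rcons.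
have -> : p = p * mxlift L 1 + p * (1 - mxlift L 1).
  by rewrite -mulrDr addrC subrK mulr1.
apply: ideal_powD.
  move: fox1; rewrite ev0 linear0 subr0 => ->; apply: ideal_pow_sum => k.
  by apply: ideal_powM => //; apply: vanishing_fox_gen.
apply: ideal_powM; first by apply: IHn => v vn; apply: p0; apply: ltnW.
by rewrite /vanishing raddfB /= rmorph1 L1 subrr.
Qed.

(** * Leading terms of germs *)

(** The properties of the first nonvanishing coefficient of a germ, stated
    without reference to its order so that they can be inherited by its slices:
    F kills commutators with Y and is linear and balanced over the commutant
    of Y. *)
Record leading_term (F : seq pt -> M) : Prop := LeadingTerm {
  leading_linear : forall u v, linear (fun Z => F (u ++ Z :: v));
  leading_comm : forall u v S, F (u ++ comm_point S Y :: v) = 0;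
  leading_nil : forall S, comm_point S Y = 0 -> S * F [::] = F [::] * S;
  leading_first : forall S, comm_point S Y = 0 ->
    forall Z v, F (lmul_point S Z :: v) = S * F (Z :: v);
  leading_mid : forall S, comm_point S Y = 0 -> forall u Z Z' v,
    F (u ++ [:: rmul_point Z S, Z' & v]) = F (u ++ [:: Z, lmul_point S Z' & v]);
  leading_last : forall S, comm_point S Y = 0 ->
    forall u Z, F (rcons u (rmul_point Z S)) = F (rcons u Z) * S }.

Definition slot_slice (F : seq pt -> M) (k : 'I_g * idx) (u : seq pt) : M :=
  slot_coef (fun Z => F (rcons u Z)) k.

Lemma lmul_slot_point (S : M) (i : 'I_g) (c d : 'I_s.+1) :
  lmul_point S (slot_point K i (c, d)) = \sum_b S b c *: slot_point K i (b, d) :> pt.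
Proof.
apply/ffunP => j; rewrite sum_ffunE !ffunE; case: eqVneq => [->|ji].
  rewrite [LHS]sum_mxunit -(pair_bigA _ (fun b e => (S * unit (c, d)) b e *: unit (b, e))).
  apply: eq_bigr => b _; rewrite (bigD1 d) //= big1 => [|e ed].
    by rewrite addr0 !ffunE eqxx mulmx_unitE eqxx mul1r.
  by rewrite mulmx_unitE (negPf ed) mul0r scale0r.
rewrite mulr0 big1 // => b _.
by rewrite !ffunE (negPf ji) scaler0.
Qed.

Lemma slot_sliceM F i d e u S a b :
    (forall u v, linear (fun Z => F (u ++ Z :: v))) ->
  (slot_slice F (i, (d, e)) u * S) a b
    = F (rcons u (lmul_point S (slot_point K i (b, d)))) a e.
Proof.
move=> linF; pose h : {linear pt -> M} := HB.pack (fun Z => F (u ++ [:: Z]))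
  (GRing.isLinear.Build K pt M *:%R _ (linF u [::])).
rewrite -cats1 -[F _]/(h _) lmul_slot_point linear_sum summxE mxE.
by apply: eq_bigr => c _; rewrite linearZ !mxE /= cats1 mulrC.
Qed.

(** Multiplying a slice by S on the right amounts to multiplying the last
    argument of F by S on the left, because S E_cd is the combination of the
    E_bd with coefficients S_bc.  Thus right linearity of a slice is the balance
    of F in its last two arguments. *)
Lemma leading_slice F k : leading_term F -> leading_term (slot_slice F k).
Proof.
case: k => i [d e] [Fl Fc Fn Ff Fm Fe]; split.
- move=> u v c Z Z'; apply/matrixP => a b; rewrite !mxE !rcons_cat /=.
  by rewrite Fl !mxE.
- move=> u v S; apply/matrixP => a b; rewrite !mxE rcons_cat /=.
  by rewrite Fc mxE.
- move=> S SY; apply/matrixP => a b; rewrite slot_sliceM // Ff // !mxE.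
  by apply: eq_bigr => c _; rewrite !mxE.
- move=> S SY Z v; apply/matrixP => a b; rewrite !mxE /= Ff // !mxE.
  by apply: eq_bigr => c _; rewrite !mxE.
- move=> S SY u Z Z' v; apply/matrixP => a b; rewrite !mxE !rcons_cat /=.
  by rewrite Fm.
- move=> S SY u Z; apply/matrixP => a b; rewrite slot_sliceM // !mxE /=.
  by rewrite -!cats1 -!catA Fm.
Qed.

Lemma sum_lift_unit : \sum_k T k * unit k = 1.
Proof. by rewrite -[RHS]L1 LT; apply: eq_bigr => k _; rewrite mulr1. Qed.

Lemma slot_slice_expansion F u (Z : pt) : leading_term F ->
  F (rcons u Z) = \sum_k slot_slice F k u * Z k.1 * unit k.2.
Proof.
move=> leadF; rewrite (@slot_expansion _ _ _ (fun Z' => F (rcons u Z'))) // => c Z1 Z2.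
by rewrite -!cats1; apply: leading_linear.
Qed.

(** The projection disappears: its left factors T_k move through the last
    argument of F by right linearity, and sum_k T_k E_k = 1. *)
Lemma slice_lift F u (Z : pt) : leading_term F ->
  \sum_k slot_slice F k u * (Z k.1 * ncpoly_eval Y (mxlift L (unit k.2)))
    = F (rcons u Z).
Proof.
move=> leadF.
under eq_bigr => k _ do rewrite LT mulrA mulr_sumr.
rewrite exchange_big -[RHS]mulr1 -sum_lift_unit mulr_sumr /=.
apply: eq_bigr => t _; rewrite mulrA -(leading_last leadF (TY t)).
rewrite slot_slice_expansion // mulr_suml; apply: eq_bigr => k _.
by rewrite ffunE !mulrA.
Qed.

(** As F kills [S, Y] in its last argument, the tensors
    sum f_k Y_i (x) E_k and sum f_k (x) Y_i E_k are equal. *)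
Lemma slice_comm F u (h : {linear M -> M}) : leading_term F ->
  \sum_k slot_slice F k u * Y k.1 * h (unit k.2)
    = \sum_k slot_slice F k u * h (Y k.1 * unit k.2).
Proof.
move=> leadF; apply: sandwich_eq => S; apply/eqP.
rewrite eq_sym -subr_eq0 -sumrB; apply/eqP.
have := slot_slice_expansion u (comm_point S Y) leadF.
rewrite -cats1 (leading_comm leadF) => {2}->; apply: eq_bigr => k _.
by rewrite !ffunE mulrBr mulrBl !mulrA.
Qed.

Lemma taylor_fox_gen k (Z : pt) : taylor (fox_gen Y L k) [:: Z] =
  Z k.1 * ncpoly_eval Y (mxlift L (unit k.2)) +
  (Y k.1 * taylor (mxlift L (unit k.2)) [:: Z]
    - taylor (mxlift L (Y k.1 * unit k.2)) [:: Z]).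
Proof.
rewrite taylorB.
rewrite [X in X - _]taylor_generatorM.
rewrite [X in _ + _ * X - _]taylor_nil.
rewrite [X in X - _]addrC.
exact: esym (addrA _ _ _).
Qed.

(** In order 0, F takes a value in the bicommutant of Y, which the projection
    fixes.  In higher order, the slices of F along the last argument are
    realized by induction and multiplied by [fox_gen]. *)
Lemma realize_leading_term n F : leading_term F ->
  exists2 p, I_pow n p & forall v, size v = n -> taylor p v = F v.
Proof.
elim: n F => [|n IHn] F leadF.
  exists (mxlift L (F [::])) => // -[|//] _.
  rewrite taylor_nil LT -[RHS]mulr1 -sum_lift_unit mulr_sumr.
  by apply: eq_bigr => k _; rewrite (leading_nil leadF (TY k)) mulrA.
have /choice[p pP] : forall k, exists p,
    I_pow n p /\ forall v, size v = n -> taylor p v = slot_slice F k v.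
  by move=> k; have [p ? ?] := IHn _ (leading_slice k leadF); exists p.
exists (\sum_k p k * fox_gen Y L k).
  apply: ideal_pow_sum => k; apply: ideal_powM; first by case: (pP k).
  exact: vanishing_fox_gen.
elim/last_ind => [//|u Z _]; rewrite size_rcons => -[un].
(* The coefficient of order 1 of the lift, as a linear map of the matrix. *)
pose h : {linear M -> M} := HB.pack (fun S => taylor (mxlift L S) [:: Z])
  (GRing.isLinear.Build K M M *:%R (fun S => taylor (mxlift L S) [:: Z])
    (fun c S S' => etrans (congr1 (fun p => taylor p [:: Z]) (mxlift_linear L c S S'))
      (taylorP Y c _ _ [:: Z]))).
rewrite taylor_sum.
transitivity (\sum_k slot_slice F k u * taylor (fox_gen Y L k) [:: Z]).
  apply: eq_bigr => k _; have [pI pF] := pP k.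
  rewrite rmorphM -[LHS]/(convolution _ _ _) convolution_rcons ?pF //.
    by rewrite un; apply: ideal_pow_vanish.
  by rewrite taylor_nil; apply: vanishing_fox_gen.
under eq_bigr => k _ do rewrite taylor_fox_gen mulrDr.
rewrite big_split /= slice_lift // -[RHS]addr0; congr (_ + _).
under eq_bigr => k _ do rewrite mulrBr mulrA.
rewrite sumrB; apply/eqP; rewrite subr_eq0; apply/eqP.
exact: (slice_comm u h leadF).
Qed.

End Lift.
End Order.

(** * Comparison of germs with the completion *)

Section Completion.
Variables (K : fieldType) (g s : nat) (Y : point K g s).
Local Notation M := 'M[K]_s.+1.
Local Notation pt := (point K g s).
Local Notation taylor := (to_germ Y).
Local Notation J := (vanishing_ideal Y).

Lemma germ_slot0 (f : germ Y) u v : f (u ++ 0 :: v) = 0.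
Proof.
have := germ_linear (germP f) u v (-1) 0 0.
by rewrite scaler0 addr0 scaleN1r addNr.
Qed.

(** Vanishing on commutators comes from the conditions in order n, whose right
    sides have order n - 1; balance over the commutant comes from those in order
    n + 1, whose left sides vanish because [S, Y] = 0. *)
Lemma leading_term_germ n (f : germ Y) : vanish_below n f ->
  leading_term Y (fun v => if size v == n then f v else 0).
Proof.
have [fl f1 ff fm fe] := germP f => f0; split.
- move=> u v c Z Z'; rewrite !size_cat /=; case: eqP => _; first exact: fl.
  by rewrite scaler0 addr0.
- move=> u v S; case: eqP => // uvn.
  case/lastP: u v uvn => [|u Z] [|Z' v] /=; rewrite ?cat_rcons => uvn.
  + by rewrite f1 f0 -?uvn // mulr0 mul0r subrr.
  + by rewrite ff !f0 -?uvn //= mulr0 subrr.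
  + by rewrite fe !f0 -?uvn ?size_cat ?addn2 ?addn1 ?mul0r ?subrr.
  + by rewrite fm !f0 -?uvn ?size_cat /= ?addnS // subrr.
- move=> S SY /=; case: eqP => _; last by rewrite mulr0 mul0r.
  apply/eqP; rewrite -subr_eq0 -f1 SY; apply/eqP; exact: (germ_slot0 f [::] [::]).
- move=> S SY Z v /=; case: eqP => _; last by rewrite mulr0.
  apply/esym/eqP; rewrite -subr_eq0 -ff SY; apply/eqP.
  exact: (germ_slot0 f [::] (Z :: v)).
- move=> S SY u Z Z' v; rewrite !size_cat /=; case: eqP => _ //.
  by apply/eqP; rewrite -subr_eq0 -fm SY -cat_rcons germ_slot0.
- move=> S SY u Z; rewrite !size_rcons /=; case: eqP => _; last by rewrite mul0r.
  by apply/eqP; rewrite -!cats1 -subr_eq0 -fe SY -cat_rcons germ_slot0.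
Qed.

Hypothesis ssY : semisimple_point Y.

Lemma ideal_powP n p : ideal_pow_set J n p <-> vanish_below n (taylor p).
Proof.
have [L [T [TY LT L1]]] := semisimple_lift ssY.
by split; [apply: ideal_pow_vanish|apply: vanish_ideal_pow TY LT L1 _ _].
Qed.

Definition agree_below n (p : ncpoly K g) (f : germ Y) :=
  forall v, (size v < n)%N -> taylor p v = f v.

(** The error of an approximation of order n has a leading term in order n;
    realizing it inside the n-th power of the ideal leaves lower orders
    unchanged. *)
Lemma germ_approximation (f : germ Y) n : exists p, agree_below n p f.
Proof.
have [L [T [TY LT L1]]] := semisimple_lift ssY.
elim: n => [|n [p pf]]; first by exists 0.
pose h := f - taylor p.
have hE v : h v = f v - taylor p v by rewrite -scaleN1r.
have h0 : vanish_below n h by move=> v vn; rewrite hE pf // subrr.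
have [q qI qh] := realize_leading_term TY LT L1 n (leading_term_germ h0).
exists (p + q) => v; rewrite ltnS leq_eqVlt -[p]scale1r taylorP scale1r.
case/predU1P => [vn|vn]; first by rewrite qh // vn eqxx hE addrC subrK.
by rewrite pf // (ideal_pow_vanish qI) // addr0.
Qed.

Lemma agree_ideal_pow n p q f : agree_below n p f ->
  agree_below n q f <-> ideal_pow_set J n (p - q).
Proof.
move=> pf; split=> [qf|/ideal_powP pq0] => [|v vn].
  by apply/ideal_powP => v vn; rewrite taylorB pf // qf // subrr.
by apply/esym/eqP; rewrite -(pf v vn) -subr_eq0 -taylorB pq0.
Qed.

Definition approximant f n : ncpoly K g := projT1 (cid (germ_approximation f n)).

Lemma approximantP f n : agree_below n (approximant f n) f.
Proof. exact: projT2 (cid (germ_approximation f n)). Qed.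

Lemma approximant_compat f l :
  quot_proj (@ideal_powS_decr _ _ J l) (quot_pi (ideal_powS J l.+1) (approximant f l.+2))
    = quot_pi (ideal_powS J l) (approximant f l.+1).
Proof.
have pf : agree_below l.+1 (approximant f l.+2) f.
  by move=> v vl; apply: approximantP; apply: ltnW.
by rewrite quot_projE; apply/quot_pi_eq/(agree_ideal_pow _ pf)/approximantP.
Qed.

Definition germ_completion (f : germ Y) : adic_completion J :=
  InvLim (approximant_compat f).

Lemma germ_completionE f p l :
  invlim_val (germ_completion f) l = quot_pi (ideal_powS J l) p
    <-> agree_below l.+1 p f.
Proof.
apply: iff_trans (quot_pi_eq _ _ _) _.
by apply: iff_sym; apply: agree_ideal_pow; apply: approximantP.
Qed.

Lemma germ_completion_taylor p : germ_completion (taylor p) = to_completion J p.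
Proof. by apply: invlimP => l; apply/germ_completionE. Qed.

Fact germ_completion_linear : linear germ_completion.
Proof.
move=> c f h; apply: invlimP => l.
rewrite -[RHS]/(c *: quot_pi _ (approximant f l.+1) + quot_pi _ (approximant h l.+1)).
rewrite -linearP; apply/germ_completionE => v vl.
by rewrite taylorP !approximantP.
Qed.

Fact germ_completion_monoid : monoid_morphism germ_completion.
Proof.
split=> [|f h]; first by rewrite -(rmorph1 taylor) germ_completion_taylor rmorph1.
apply: invlimP => l.
rewrite -[RHS]/(quot_pi _ (approximant f l.+1) * quot_pi _ (approximant h l.+1)).
rewrite -rmorphM; apply/germ_completionE => v vl; rewrite rmorphM.
apply: eq_bigr => i _; rewrite !approximantP //.
  by rewrite size_drop (leq_ltn_trans _ vl) ?leq_subr.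
by rewrite (leq_ltn_trans _ vl) ?size_take_min ?geq_minr.
Qed.

HB.instance Definition _ := GRing.isLinear.Build K (germ Y) (adic_completion J)
  *:%R germ_completion germ_completion_linear.
HB.instance Definition _ := GRing.isMonoidMorphism.Build (germ Y) (adic_completion J)
  germ_completion germ_completion_monoid.

Definition germ_completion_lrmorphism : {lrmorphism germ Y -> adic_completion J} :=
  germ_completion.

Lemma germ_completion_inj : injective germ_completion.
Proof.
move=> f h fh; apply: germ_eq => v.
have := erefl (invlim_val (germ_completion f) (size v)); rewrite {1}fh.
by move=> /esym/germ_completionE; rewrite -(@approximantP h (size v).+1) // => ->.
Qed.

(** The coefficient of order l is read off from a representative modulo the
    power l + 1 of the ideal.  Higher representatives give the same value, so
    finitely many orders can be compared within one polynomial, whose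
    coefficients satisfy the conditions on germs. *)
Lemma germ_completion_surj x : exists f, germ_completion f = x.
Proof.
pose p l := repr (invlim_val x l).
have xE l : invlim_val x l = quot_pi (ideal_powS J l) (p l) by rewrite quot_piK.
have pS l v : (size v <= l)%N -> taylor (p l.+1) v = taylor (p l) v.
  move=> vl; apply/eqP; rewrite -subr_eq0 -taylorB.
  suff /ideal_powP-> : ideal_pow_set J l.+1 (p l.+1 - p l) by [].
  by apply/(quot_pi_eq (ideal_powS J l)); rewrite -(xE l) -invlim_compat xE [RHS]quot_projE.
have pE l v : (size v <= l)%N -> taylor (p (size v)) v = taylor (p l) v.
  move=> /subnK<-; elim: (l - size v)%N => // m IHm.
  by rewrite addSn pS ?leq_addl.
pose f v := taylor (p (size v)) v.
have germ_f : is_germ Y f.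
  split=> [u v c Z Z'|S|S Z v|S u Z Z' v|S u Z]; rewrite /f.
  - by rewrite !size_cat /= (germ_linear (germP _)).
  - by rewrite (@pE 1%N [::]) // (germ_comm1 (germP _)).
  - rewrite (@pE (size v).+2 (Z :: v)) // (@pE (size v).+2 (lmul_point S Z :: v)) //.
    exact: germ_comm_first (germP _) _ _ _.
  - set l := size (u ++ [:: Z, _, Z' & v]).
    have ul Z1 Z2 : (size (u ++ [:: Z1, Z2 & v]) <= l)%N by rewrite /l !size_cat leq_add2l.
    by rewrite !(@pE l (u ++ _)) // (germ_comm_mid (germP _)).
  - set l := size (u ++ [:: Z; _]).
    have ul Z1 : (size (u ++ [:: Z1]) <= l)%N by rewrite /l !size_cat leq_add2l.
    rewrite (@pE l (u ++ [:: rmul_point Z S])) // (@pE l (u ++ [:: Z])) //.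
    exact: germ_comm_last (germP _) _ _ _.
exists (Germ germ_f); apply: invlimP => l; rewrite xE.
by apply/germ_completionE => v vl; apply/esym/pE.
Qed.

Lemma germ_completion_bij : bijective germ_completion.
Proof.
have /choice[h hK] := germ_completion_surj.
by exists h => // f; apply: germ_completion_inj.
Qed.

End Completion.

Theorem theorem5 (R : realType) (g s : nat) (Y : point R[i] g s)
    (hY : semisimple_point Y) :
  exists phi : {lrmorphism germ Y -> adic_completion (vanishing_ideal Y)},
    bijective phi /\
    forall p : ncpoly R[i] g,
      phi (to_germ Y p) = to_completion (vanishing_ideal Y) p.
Proof.
exists (germ_completion_lrmorphism hY); split.
  exact: germ_completion_bij.
exact: germ_completion_taylor.
Qed.
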